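(* For each $i\in\{1,\ldots,9\}$, let $\mathsf{Props}_i$ be the set of properties given in the context, let $\Sigma_i$ be the signature consisting of all the operation and relation symbols occurring in $\mathsf{Props}_i$, and let $r_i=(\underline{\mathcal B},T,\underline{\mathcal C}_i,I_i,R_i)$, where: (a) $\underline{\mathcal B}$ is the category of $\Sigma_{\mathsf{ctor}}$-models and $T=\mathcal{T}r(\Sigma_{\mathsf{ctor}})$; (b) $\underline{\mathcal C}_i$ is the category of $(\Sigma_i,\mathsf{Props}_i)$-models (with $\Sigma_i$-model morphisms) and $I_i=\mathcal{T}r(\Sigma_i)$; (c) $R_i:\underline{\mathcal C}_i\to\underline{\mathcal B}$ is the forgetful functor sending $(\Sigma_i,\mathsf{Props}_i)$-models to their underlying $\Sigma_{\mathsf{ctor}}$-models. Then, for every $i\in\{1,\ldots,9\}$, $r_i$ is an epi-recursor. In particular, $\mathcal{T}r(\Sigma_i)$ is the initial $(\Sigma_i,\mathsf{Props}_i)$-model.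
   Context: **Epi-recursors.** An epi-recursor is a tuple $r=(\underline{\mathcal B},T,\underline{\mathcal C},I,R)$ where $\underline{\mathcal B}$ is a category (the base category), $T$ is an object of $\underline{\mathcal B}$ (the base object), $\underline{\mathcal C}$ is a category (the extended category), $I$ is an initial object of $\underline{\mathcal C}$, and $R:\underline{\mathcal C}\to\underline{\mathcal B}$ is a functor with $R\,I=T$. **Terms.** $\mathsf{Var}$ is a countably infinite set of variables. $\mathsf{Tr}$ is the set of $\lambda$-terms over $\mathsf{Var}$, i.e. $\alpha$-equivalence classes of the preterms freely generated by the grammar $p::=\mathsf{PVr}\,x\mid\mathsf{PAp}\,p_1\,p_2\mid\mathsf{PLm}\,x\,p$ (where $\mathsf{PLm}\,x\,p$ binds $x$ in $p$), with induced constructors $\mathsf{Vr}:\mathsf{Var}\to\mathsf{Tr}$, $\mathsf{Ap}:\mathsf{Tr}\to\mathsf{Tr}\to\mathsf{Tr}$, $\mathsf{Lm}:\mathsf{Var}\to\mathsf{Tr}\to\mathsf{Tr}$. $\mathsf{Perm}$ is the set of bijections $\sigma:\mathsf{Var}\to\mathsf{Var}$ with $\mathsf{supp}\,\sigma=\{x\mid\sigma\,x\neq x\}$ finite; $\mathsf{id}$ is the identity; $x\leftrightarrow y$ is the transposition of $x$ and $y$. For variables, $x[z_1\wedge z_2]=(z_1\leftrightarrow z_2)(x)$, and $x[y/z]$ is $y$ if $x=z$ and $x$ otherwise. The standard operators on terms are: permutation $t[\sigma]$ (apply $\sigma$ to all variables of $t$, free, bound and binding), swapping $t[x\wedge y]=t[x\leftrightarrow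 y]$, capture-avoiding substitution $t[s/x]$ of the term $s$ for the variable $x$ in $t$, renaming $t[y/x]=t[(\mathsf{Vr}\,y)/x]$, the free-variable operator $\mathsf{FV}\,t$, and freshness $x\,\#\,t$ iff $x\notin\mathsf{FV}\,t$. **Signatures and models.** The symbols are $\mathsf{vr},\mathsf{ap},\mathsf{lm},\mathsf{pm},\mathsf{sw},\mathsf{sb},\mathsf{ren},\mathsf{fv},\mathsf{fr}$; a signature is a set of symbols. $\Sigma_{\mathsf{ctor}}=\{\mathsf{vr},\mathsf{ap},\mathsf{lm}\}$. A $\Sigma$-model $\mathcal M$ consists of a carrier set $M$ and, for each symbol in $\Sigma$, an operation/relation: $\mathsf{vr}$: $\mathsf{Vr}^{\mathcal M}:\mathsf{Var}\to M$; $\mathsf{ap}$: $\mathsf{Ap}^{\mathcal M}:M\to M\to M$; $\mathsf{lm}$: $\mathsf{Lm}^{\mathcal M}:\mathsf{Var}\to M\to M$; $\mathsf{pm}$: $\_[\_]^{\mathcal M}:M\to\mathsf{Perm}\to M$; $\mathsf{sw}$: $\_[\_\wedge\_]^{\mathcal M}:M\to\mathsf{Var}\to\mathsf{Var}\to M$; $\mathsf{sb}$: $\_[\_/\_]^{\mathcal M}:M\to M\to\mathsf{Var}\to M$; $\mathsf{ren}$: $\_[\_/\_]^{\mathcal M}:M\to\mathsf{Var}\to\mathsf{Var}\to M$; $\mathsf{fv}$: $\mathsf{FV}^{\mathcal M}:M\to\mathcal P(\mathsf{Var})$; $\mathsf{fr}$: $\#^{\mathcal M}:\mathsf{Var}\to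 M\to\mathsf{Bool}$. A morphism $g:\mathcal M\to\mathcal M'$ of $\Sigma$-models is a function $g:M\to M'$ commuting with all the operations for symbols in $\Sigma\cap\{\mathsf{vr},\mathsf{ap},\mathsf{lm},\mathsf{pm},\mathsf{sw},\mathsf{sb},\mathsf{ren}\}$ (e.g. $g(\mathsf{Lm}^{\mathcal M}x\,m)=\mathsf{Lm}^{\mathcal M'}x\,(g\,m)$, $g(m[n/x]^{\mathcal M})=(g\,m)[(g\,n)/x]^{\mathcal M'}$), and such that $x\,\#^{\mathcal M}\,m$ implies $x\,\#^{\mathcal M'}(g\,m)$ if $\mathsf{fr}\in\Sigma$, and $\mathsf{FV}^{\mathcal M'}(g\,m)\subseteq\mathsf{FV}^{\mathcal M}m$ if $\mathsf{fv}\in\Sigma$. $\mathcal{T}r(\Sigma)$ is the $\Sigma$-model with carrier $\mathsf{Tr}$ and the standard operators on terms. **Properties** (interpreted in a model $\mathcal M$, superscripts omitted; $m,m_1,m_2,n$ range over $M$; $x,x',x_i,y,y_i,z,z_i$ over $\mathsf{Var}$; $\sigma,\tau$ over $\mathsf{Perm}$; all universally quantified unless said otherwise). Swapping: SwVr: $(\mathsf{Vr}\,x)[z_1\wedge z_2]=\mathsf{Vr}(x[z_1\wedge z_2])$. SwAp: $(\mathsf{Ap}\,m_1\,m_2)[z_1\wedge z_2]=\mathsf{Ap}(m_1[z_1\wedge z_2])(m_2[z_1\wedge z_2])$. SwLm: $(\mathsf{Lm}\,x\,m)[z_1\wedge z_2]=\mathsf{Lm}(x[z_1\wedge z_2])(m[z_1\wedge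 z_2])$. SwId: $m[z\wedge z]=m$. SwIv: $m[x\wedge y][x\wedge y]=m$. SwCp: $m[x\wedge y][z_1\wedge z_2]=(m[z_1\wedge z_2])[(x[z_1\wedge z_2])\wedge(y[z_1\wedge z_2])]$. SwFv: if $x,y\notin\mathsf{FV}\,m$ then $m[x\wedge y]=m$. SwCg: if $z\notin\{x_1,x_2\}$, $z\,\#\,m_1$, $z\,\#\,m_2$ and $m_1[z\wedge x_1]=m_2[z\wedge x_2]$ then $\mathsf{Lm}\,x_1\,m_1=\mathsf{Lm}\,x_2\,m_2$. SwBvr: if $x'\neq x$ and $x'\,\#\,m$ then $\mathsf{Lm}\,x\,m=\mathsf{Lm}\,x'(m[x'\wedge x])$. Permutation: PmVr: $(\mathsf{Vr}\,x)[\sigma]=\mathsf{Vr}(\sigma\,x)$. PmAp: $(\mathsf{Ap}\,m_1\,m_2)[\sigma]=\mathsf{Ap}(m_1[\sigma])(m_2[\sigma])$. PmLm: $(\mathsf{Lm}\,x\,m)[\sigma]=\mathsf{Lm}(\sigma\,x)(m[\sigma])$. PmId: $m[\mathsf{id}]=m$. PmCp: $m[\sigma][\tau]=m[\tau\circ\sigma]$. PmFv: if $\mathsf{supp}\,\sigma\cap\mathsf{FV}\,m=\emptyset$ then $m[\sigma]=m$. Substitution: SbVr: $(\mathsf{Vr}\,x)[n/z]=$ (if $x=z$ then $n$ else $\mathsf{Vr}\,x$). SbAp: $(\mathsf{Ap}\,m_1\,m_2)[n/z]=\mathsf{Ap}(m_1[n/z])(m_2[n/z])$. SbLm: if $x\neq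 z$ and $x\,\#\,n$ then $(\mathsf{Lm}\,x\,m)[n/z]=\mathsf{Lm}\,x(m[n/z])$. SbBvr: if $x'\neq x$ and $x'\,\#\,m$ then $\mathsf{Lm}\,x\,m=\mathsf{Lm}\,x'(m[(\mathsf{Vr}\,x')/x])$. Renaming: RnVr: $(\mathsf{Vr}\,x)[y/z]=\mathsf{Vr}(x[y/z])$. RnAp: $(\mathsf{Ap}\,m_1\,m_2)[y/z]=\mathsf{Ap}(m_1[y/z])(m_2[y/z])$. RnLm$_1$: if $x\notin\{y,z\}$ then $(\mathsf{Lm}\,x\,m)[y/z]=\mathsf{Lm}\,x(m[y/z])$. RnLm$_2$: $(\mathsf{Lm}\,x\,m)[z/x]=\mathsf{Lm}\,x\,m$. RnBvr: if $x'\neq x$ and $x'\,\#\,m$ then $\mathsf{Lm}\,x\,m=\mathsf{Lm}\,x'(m[x'/x])$. RnBvr$_2$: if $y\neq x'$ then $\mathsf{Lm}\,x(m[y/x'])=\mathsf{Lm}\,x'(m[y/x'][x'/x])$. RnId: $m[z/z]=m$. RnIm: if $x_1\neq y$ then $m[x_1/y][x_2/y]=m[x_1/y]$. RnCh: if $y\neq x_2$ then $m[y/x_2][x_2/x_1][x_3/x_2]=m[y/x_2][x_3/x_1]$. RnCm: if $x_2\neq y_1\neq x_1\neq y_2$ then $m[x_2/x_1][y_2/y_1]=m[y_2/y_1][x_2/x_1]$. Freshness/freeness: FrVr: if $z\neq x$ then $z\,\#\,\mathsf{Vr}\,x$. FrAp: if $z\,\#\,m_1$ and $z\,\#\,m_2$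 then $z\,\#\,\mathsf{Ap}\,m_1\,m_2$. FrLm: if $z=x$ or $z\,\#\,m$ then $z\,\#\,\mathsf{Lm}\,x\,m$. FvVr: $\mathsf{FV}(\mathsf{Vr}\,x)\subseteq\{x\}$. FvAp: $\mathsf{FV}(\mathsf{Ap}\,m_1\,m_2)\subseteq\mathsf{FV}\,m_1\cup\mathsf{FV}\,m_2$. FvLm: $\mathsf{FV}(\mathsf{Lm}\,x\,m)\subseteq\mathsf{FV}\,m\setminus\{x\}$. FvDPm: $\mathsf{FV}\,m=\{x\mid\{y\mid m[x\leftrightarrow y]\neq m\}\text{ is infinite}\}$. FvDSw: $\mathsf{FV}\,m=\{x\mid\{y\mid m[x\wedge y]\neq m\}\text{ is infinite}\}$. FCB: there exists $x\in\mathsf{Var}$ such that $x\notin\mathsf{FV}(\mathsf{Lm}\,x\,m)$ for all $m\in M$. A $(\Sigma,\mathsf{Props})$-model is a $\Sigma$-model satisfying all properties in $\mathsf{Props}$. **The sets $\mathsf{Props}_i$.** $\mathsf{Props}_1$ (perm/free): PmVr, PmAp, PmLm, PmId, PmCp, FvDPm, FCB. $\mathsf{Props}_2$ (perm/free variant): PmVr, PmAp, PmLm, PmId, PmCp, PmFv, FvVr, FvAp, FvLm. $\mathsf{Props}_3$ (swap/free variant): SwVr, SwAp, SwLm, SwId, SwIv, SwCp, FvDSw, FCB. $\mathsf{Props}_4$ (swap/free): SwVr, SwAp, SwLm, SwFv, FvVr, FvAp, FvLm. $\mathsf{Props}_5$ (swap/fresh variant): SwVr, SwAp, SwLm, SwBvr,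 FrVr, FrAp, FrLm. $\mathsf{Props}_6$ (swap/fresh): SwVr, SwAp, SwLm, SwCg, FrVr, FrAp, FrLm. $\mathsf{Props}_7$ (subst/fresh): SbVr, SbAp, SbLm, SbBvr, FrVr, FrAp, FrLm. $\mathsf{Props}_8$ (renaming): RnVr, RnAp, RnLm$_1$, RnLm$_2$, RnBvr$_2$, RnId, RnIm, RnCh, RnCm. $\mathsf{Props}_9$ (renaming/fresh variant): RnVr, RnAp, RnLm$_1$, RnBvr, FrVr, FrAp, FrLm. *)

(* Defs.v *)
From HB Require Import structures.
From mathcomp Require Import all_boot.
From mathcomp Require Import boolp classical_sets functions cardinality.
From mathcomp Require Import generic_quotient.
From Stdlib Require List.

Set Implicit Arguments.
Unset Strict Implicit.
Unset Printing Implicit Defensive.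

Local Open Scope classical_set_scope.
Local Open Scope quotient_scope.

Record category := Category {
  obj :> Type;
  hom : obj -> obj -> Type;
  idm : forall A, hom A A;
  comp : forall A B C, hom B C -> hom A B -> hom A C;
  comp_idl : forall A B (f : hom A B), comp (idm B) f = f;
  comp_idr : forall A B (f : hom A B), comp f (idm A) = f;
  comp_assoc : forall A B C D (h : hom C D) (g : hom B C) (f : hom A B),
    comp h (comp g f) = comp (comp h g) f }.

Record functor (C D : category) := Functor {
  fobj :> C -> D;
  fmap : forall A B : C, hom A B -> hom (fobj A) (fobj B);
  fmap_id : forall A : C, fmap (idm A) = idm (fobj A);
  fmap_comp : forall (X Y Z : C) (g : hom Y Z) (f : hom X Y),
    fmap (comp g f) = comp (fmap g) (fmap f) }.

Definition initial (C : category) (I : C) : Prop :=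
  forall X : C, exists f : hom I X, forall g : hom I X, g = f.

Record recursor_tuple := RecursorTuple {
  base_cat : category;
  base_obj : base_cat;
  ext_cat : category;
  ext_obj : ext_cat;
  ext_functor : functor ext_cat base_cat }.

Definition epi_recursor (r : recursor_tuple) : Prop :=
  initial (ext_obj r) /\ ext_functor r (ext_obj r) = base_obj r.

Section Variables.
Variable Var : countType.

Definition supp (f : Var -> Var) : set Var := [set x | f x <> x].

Record perm := Perm {
  pfun :> Var -> Var;
  perm_bij : bijective pfun;
  perm_fin : finite_set (supp pfun) }.

Lemma bij_id : bijective (@id Var).
Proof. by exists id. Qed.

Lemma fin_id : finite_set (supp id).
Proof. by rewrite (_ : supp id = set0) // -subset0 => x; apply. Qed.

Definition id_perm : perm := Perm bij_id fin_id.

Lemma bij_comp_perm (s t : perm) : bijective (s \o t).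
Proof. exact: bij_comp (perm_bij s) (perm_bij t). Qed.

Lemma fin_comp_perm (s t : perm) : finite_set (supp (s \o t)).
Proof.
apply: (@sub_finite_set _ _ (supp s `|` supp t)); last first.
  by rewrite finite_setU; split; exact: perm_fin.
move=> x /= st; have [tx|tx] := pselect (t x = x); last by right.
by left => sx; apply: st; rewrite /= tx.
Qed.

Definition comp_perm (s t : perm) : perm :=
  Perm (bij_comp_perm s t) (fin_comp_perm s t).

Definition swap_var (z1 z2 x : Var) : Var :=
  if x == z1 then z2 else if x == z2 then z1 else x.

Lemma swap_varK (z1 z2 : Var) : involutive (swap_var z1 z2).
Proof.
move=> x; rewrite /swap_var.
have [->|x1] := eqVneq x z1; first by rewrite eqxx; case: eqVneq.
by have [->|x2] := eqVneq x z2; rewrite ?eqxx // (negbTE x1) (negbTE x2).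
Qed.

Lemma fin_swap_var (z1 z2 : Var) : finite_set (supp (swap_var z1 z2)).
Proof.
apply: (@sub_finite_set _ _ [set z1; z2]); last exact: finite_set2.
move=> x /=; rewrite /supp /swap_var /=.
have [->|_] := eqVneq x z1; first by left.
by have [->|_] := eqVneq x z2; first by right.
Qed.

Definition transp (z1 z2 : Var) : perm :=
  Perm (inv_bij (swap_varK z1 z2)) (fin_swap_var z1 z2).

Definition ren_var (y z x : Var) : Var := if x == z then y else x.

Inductive preterm :=
| PVr of Var
| PAp of preterm & preterm
| PLm of Var & preterm.

HB.instance Definition _ := gen_eqMixin preterm.
HB.instance Definition _ := gen_choiceMixin preterm.

Fixpoint pvars (p : preterm) : set Var :=
  match p with
  | PVr x => [set x]
  | PAp p q => pvars p `|` pvars q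
  | PLm x p => x |` pvars p
  end.

Fixpoint pFV (p : preterm) : set Var :=
  match p with
  | PVr x => [set x]
  | PAp p q => pFV p `|` pFV q
  | PLm x p => pFV p `\ x
  end.

Fixpoint pperm (s : Var -> Var) (p : preterm) : preterm :=
  match p with
  | PVr x => PVr (s x)
  | PAp p q => PAp (pperm s p) (pperm s q)
  | PLm x p => PLm (s x) (pperm s p)
  end.

(* The least congruence that changes a bound variable x into a y not occurring
   in its scope; as y does not occur there, exchanging x and y amounts to
   replacing all the occurrences of x by y. *)
Inductive alpha : preterm -> preterm -> Prop :=
| alpha_refl p : alpha p p
| alpha_sym p q : alpha p q -> alpha q p
| alpha_trans p q r : alpha p q -> alpha q r -> alpha p r
| alpha_ap p p' q q' : alpha p p' -> alpha q q' -> alpha (PAp p q) (PAp p' q')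
| alpha_lm x p p' : alpha p p' -> alpha (PLm x p) (PLm x p')
| alpha_bound x y p : ~ pvars p y ->
    alpha (PLm x p) (PLm y (pperm (swap_var x y) p)).

Definition alphab (p q : preterm) : bool := `[< alpha p q >].

Lemma alphab_refl : reflexive alphab.
Proof. by move=> p; apply/asboolP; exact: alpha_refl. Qed.

Lemma alphab_sym : symmetric alphab.
Proof. by move=> p q; apply/asboolP/asboolP; exact: alpha_sym. Qed.

Lemma alphab_trans : transitive alphab.
Proof.
by move=> q p r /asboolP pq /asboolP qr; apply/asboolP; exact: alpha_trans qr.
Qed.

Canonical alpha_equiv := EquivRel alphab alphab_refl alphab_sym alphab_trans.

Definition term := {eq_quot alpha_equiv}.

(* A variable outside A; the default x is only returned when A is everything,
   which does not happen for a finite A and infinitely many variables. *)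
Definition fresh (x : Var) (A : set Var) : Var := xget x (~` A).

(* Parallel substitution, renaming every bound variable to one that is fresh
   for the substituted image of the free variables of the abstraction. *)
Fixpoint psubst (r : Var -> preterm) (p : preterm) : preterm :=
  match p with
  | PVr x => r x
  | PAp p q => PAp (psubst r p) (psubst r q)
  | PLm x p =>
      let x' := fresh x (\bigcup_(y in pFV p `\ x) pFV (r y)) in
      PLm x' (psubst (fun y => if y == x then PVr x' else r y) p)
  end.

Definition Vr (x : Var) : term := \pi_term (PVr x).
Definition Ap (t u : term) : term := \pi_term (PAp (repr t) (repr u)).
Definition Lm (x : Var) (t : term) : term := \pi_term (PLm x (repr t)).
Definition perm_term (t : term) (s : perm) : term := \pi_term (pperm s (repr t)).
Definition swap_term (t : term) (x y : Var) : term := perm_term t (transp x y).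
Definition subst_term (t s : term) (x : Var) : term :=
  \pi_term (psubst (fun y => if y == x then repr s else PVr y) (repr t)).
Definition ren_term (t : term) (y x : Var) : term := subst_term t (Vr y) x.
Definition FV_term (t : term) : set Var := pFV (repr t).
Definition fresh_term (x : Var) (t : term) : bool := x \notin FV_term t.

End Variables.

Inductive symbol := vr | ap | lm | pm | sw | sb | ren | fv | fr.

Definition symbol_eqb (s s' : symbol) : bool :=
  match s, s' with
  | vr, vr | ap, ap | lm, lm | pm, pm | sw, sw | sb, sb | ren, ren
  | fv, fv | fr, fr => true
  | _, _ => false
  end.

Lemma symbol_eqP : Equality.axiom symbol_eqb.
Proof. by case; case; constructor. Qed.

HB.instance Definition _ := hasDecEq.Build symbol symbol_eqP.

(* Only membership in the list matters. *)
Definition signature := seq symbol.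

Definition sig_ctor : signature := [:: vr; ap; lm].

Section Models.
Variable Var : countType.

Definition op_type (s : symbol) (M : Type) : Type :=
  match s with
  | vr => Var -> M
  | ap => M -> M -> M
  | lm => Var -> M -> M
  | pm => M -> perm Var -> M
  | sw => M -> Var -> Var -> M
  | sb => M -> M -> Var -> M
  | ren => M -> Var -> Var -> M
  | fv => M -> set Var
  | fr => Var -> M -> bool
  end.

Record model (S : signature) := Model {
  carrier :> Type;
  interp : forall s : symbol, s \in S -> op_type s carrier }.

Definition reduct (S S' : signature) (h : {subset S' <= S}) (M : model S) :
    model S' :=
  Model (fun s hs => interp M (h s hs)).

Definition preserves (s : symbol) (M M' : Type) (g : M -> M') :
    op_type s M -> op_type s M' -> Prop :=
  match s with
  | vr => fun o o' => forall x, g (o x) = o' x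
  | ap => fun o o' => forall m n, g (o m n) = o' (g m) (g n)
  | lm => fun o o' => forall x m, g (o x m) = o' x (g m)
  | pm => fun o o' => forall m s, g (o m s) = o' (g m) s
  | sw => fun o o' => forall m x y, g (o m x y) = o' (g m) x y
  | sb => fun o o' => forall m n x, g (o m n x) = o' (g m) (g n) x
  | ren => fun o o' => forall m y x, g (o m y x) = o' (g m) y x
  | fv => fun o o' => forall m, o' (g m) `<=` o m
  | fr => fun o o' => forall x m, o x m -> o' x (g m)
  end.

Definition is_morphism (S : signature) (M M' : model S) (g : M -> M') : Prop :=
  forall (s : symbol) (hs : s \in S), preserves g (interp M hs) (interp M' hs).

Definition morphism (S : signature) (M M' : model S) : Type :=
  {g : M -> M' | is_morphism g}.

Lemma is_morphism_id (S : signature) (M : model S) : is_morphism (@id M).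
Proof. by move=> s; case: s => hs //= m. Qed.

Lemma is_morphism_comp (S : signature) (M1 M2 M3 : model S)
    (g : M2 -> M3) (f : M1 -> M2) :
  is_morphism g -> is_morphism f -> is_morphism (g \o f).
Proof.
move=> hg hf s hs; move: (hg s hs) (hf s hs) => {}hg {}hf.
case: s hs hg hf => hs /= hg hf; try by move=> *; rewrite /= ?hf ?hg.
  by move=> m; apply: subset_trans (hg _) (hf _).
by move=> x m /hf /hg.
Qed.

Definition id_morphism (S : signature) (M : model S) : morphism M M :=
  exist _ id (is_morphism_id M).

Definition comp_morphism (S : signature) (M1 M2 M3 : model S)
    (g : morphism M2 M3) (f : morphism M1 M2) : morphism M1 M3 :=
  exist _ (sval g \o sval f) (is_morphism_comp (svalP g) (svalP f)).

Lemma morphism_eq (S : signature) (M M' : model S) (f g : morphism M M') :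
  sval f = sval g -> f = g.
Proof. by case: f g => [f hf] [g hg] /= fg; apply: eq_exist. Qed.

Definition models (S : signature) : category.
Proof.
by refine (@Category (model S) (@morphism S) (@id_morphism S)
  (@comp_morphism S) _ _ _) => *; apply: morphism_eq.
Defined.

Definition std_op (s : symbol) : op_type s (term Var) :=
  match s with
  | vr => @Vr Var
  | ap => @Ap Var
  | lm => @Lm Var
  | pm => @perm_term Var
  | sw => @swap_term Var
  | sb => @subst_term Var
  | ren => @ren_term Var
  | fv => @FV_term Var
  | fr => @fresh_term Var
  end.

Definition term_model (S : signature) : model S := Model (fun s _ => std_op s).

(* A property comes with the symbols occurring in it, and is only interpreted
   through these. *)
Record property := Property {
  symbols : signature;
  holds : model symbols -> Prop }.

Definition satisfies (S : signature) (M : model S) (P : property) : Prop :=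
  exists h : {subset symbols P <= S}, @holds P (reduct h M).

Definition satisfies_all (S : signature) (M : model S) (Ps : seq property) :
    Prop :=
  List.Forall (satisfies M) Ps.

Definition signature_of (Ps : seq property) : signature :=
  flatten [seq symbols P | P <- Ps].

Definition models_sat (S : signature) (Ps : seq property) : category.
Proof.
by refine (@Category {M : model S | satisfies_all M Ps}
  (fun M M' => morphism (sval M) (sval M'))
  (fun M => id_morphism (sval M))
  (fun M1 M2 M3 g f => comp_morphism g f) _ _ _) => *; apply: morphism_eq.
Defined.

Definition reduct_morphism (S S' : signature) (h : {subset S' <= S})
    (M M' : model S) (g : morphism M M') :
    morphism (reduct h M) (reduct h M') :=
  exist (fun k : reduct h M -> reduct h M' => is_morphism k)
    (sval g) (fun s hs => svalP g s (h s hs)).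

Definition forgetful (S S' : signature) (Ps : seq property)
    (h : {subset S' <= S}) : functor (models_sat S Ps) (models S').
Proof.
by refine (@Functor (models_sat S Ps) (models S')
  (fun M => reduct h (sval M))
  (fun M M' g => reduct_morphism h g) _ _) => *; apply: morphism_eq.
Defined.

(* isT proves, by computation, that a symbol belongs to a concrete list. *)
Local Notation Vr M := (@interp _ M vr isT).
Local Notation Ap M := (@interp _ M ap isT).
Local Notation Lm M := (@interp _ M lm isT).
Local Notation Pm M := (@interp _ M pm isT).
Local Notation Sw M := (@interp _ M sw isT).
Local Notation Sb M := (@interp _ M sb isT).
Local Notation Rn M := (@interp _ M ren isT).
Local Notation FV M := (@interp _ M fv isT).
Local Notation Fr M := (@interp _ M fr isT).

Definition SwVr := @Property [:: vr; sw] (fun M => forall x z1 z2,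
  Sw M (Vr M x) z1 z2 = Vr M (swap_var z1 z2 x)).
Definition SwAp := @Property [:: ap; sw] (fun M => forall m1 m2 z1 z2,
  Sw M (Ap M m1 m2) z1 z2 = Ap M (Sw M m1 z1 z2) (Sw M m2 z1 z2)).
Definition SwLm := @Property [:: lm; sw] (fun M => forall x m z1 z2,
  Sw M (Lm M x m) z1 z2 = Lm M (swap_var z1 z2 x) (Sw M m z1 z2)).
Definition SwId := @Property [:: sw] (fun M => forall m z,
  Sw M m z z = m).
Definition SwIv := @Property [:: sw] (fun M => forall m x y,
  Sw M (Sw M m x y) x y = m).
Definition SwCp := @Property [:: sw] (fun M => forall m x y z1 z2,
  Sw M (Sw M m x y) z1 z2 =
  Sw M (Sw M m z1 z2) (swap_var z1 z2 x) (swap_var z1 z2 y)).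
Definition SwFv := @Property [:: sw; fv] (fun M => forall m x y,
  x \notin FV M m -> y \notin FV M m -> Sw M m x y = m).
Definition SwCg := @Property [:: lm; sw; fr] (fun M => forall m1 m2 x1 x2 z,
  z != x1 -> z != x2 -> Fr M z m1 -> Fr M z m2 ->
  Sw M m1 z x1 = Sw M m2 z x2 -> Lm M x1 m1 = Lm M x2 m2).
Definition SwBvr := @Property [:: lm; sw; fr] (fun M => forall m x x',
  x' != x -> Fr M x' m -> Lm M x m = Lm M x' (Sw M m x' x)).

Definition PmVr := @Property [:: vr; pm] (fun M => forall x s,
  Pm M (Vr M x) s = Vr M (s x)).
Definition PmAp := @Property [:: ap; pm] (fun M => forall m1 m2 s,
  Pm M (Ap M m1 m2) s = Ap M (Pm M m1 s) (Pm M m2 s)).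
Definition PmLm := @Property [:: lm; pm] (fun M => forall x m s,
  Pm M (Lm M x m) s = Lm M (s x) (Pm M m s)).
Definition PmId := @Property [:: pm] (fun M => forall m,
  Pm M m (id_perm Var) = m).
Definition PmCp := @Property [:: pm] (fun M => forall m s t,
  Pm M (Pm M m s) t = Pm M m (comp_perm t s)).
Definition PmFv := @Property [:: pm; fv] (fun M =>
  forall m (s : perm Var), supp s `&` FV M m = set0 -> Pm M m s = m).

Definition SbVr := @Property [:: vr; sb] (fun M => forall x n z,
  Sb M (Vr M x) n z = if x == z then n else Vr M x).
Definition SbAp := @Property [:: ap; sb] (fun M => forall m1 m2 n z,
  Sb M (Ap M m1 m2) n z = Ap M (Sb M m1 n z) (Sb M m2 n z)).
Definition SbLm := @Property [:: lm; sb; fr] (fun M => forall x m n z,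
  x != z -> Fr M x n -> Sb M (Lm M x m) n z = Lm M x (Sb M m n z)).
Definition SbBvr := @Property [:: vr; lm; sb; fr] (fun M => forall m x x',
  x' != x -> Fr M x' m -> Lm M x m = Lm M x' (Sb M m (Vr M x') x)).

Definition RnVr := @Property [:: vr; ren] (fun M => forall x y z,
  Rn M (Vr M x) y z = Vr M (ren_var y z x)).
Definition RnAp := @Property [:: ap; ren] (fun M => forall m1 m2 y z,
  Rn M (Ap M m1 m2) y z = Ap M (Rn M m1 y z) (Rn M m2 y z)).
Definition RnLm1 := @Property [:: lm; ren] (fun M => forall x m y z,
  x != y -> x != z -> Rn M (Lm M x m) y z = Lm M x (Rn M m y z)).
Definition RnLm2 := @Property [:: lm; ren] (fun M => forall x m z,
  Rn M (Lm M x m) z x = Lm M x m).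
Definition RnBvr := @Property [:: lm; ren; fr] (fun M => forall m x x',
  x' != x -> Fr M x' m -> Lm M x m = Lm M x' (Rn M m x' x)).
Definition RnBvr2 := @Property [:: lm; ren] (fun M => forall m x x' y,
  y != x' -> Lm M x (Rn M m y x') = Lm M x' (Rn M (Rn M m y x') x' x)).
Definition RnId := @Property [:: ren] (fun M => forall m z,
  Rn M m z z = m).
Definition RnIm := @Property [:: ren] (fun M => forall m x1 x2 y,
  x1 != y -> Rn M (Rn M m x1 y) x2 y = Rn M m x1 y).
Definition RnCh := @Property [:: ren] (fun M => forall m x1 x2 x3 y,
  y != x2 ->
  Rn M (Rn M (Rn M m y x2) x2 x1) x3 x2 = Rn M (Rn M m y x2) x3 x1).
Definition RnCm := @Property [:: ren] (fun M => forall m x1 x2 y1 y2,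
  x2 != y1 -> y1 != x1 -> x1 != y2 ->
  Rn M (Rn M m x2 x1) y2 y1 = Rn M (Rn M m y2 y1) x2 x1).

Definition FrVr := @Property [:: vr; fr] (fun M => forall x z,
  z != x -> Fr M z (Vr M x)).
Definition FrAp := @Property [:: ap; fr] (fun M => forall m1 m2 z,
  Fr M z m1 -> Fr M z m2 -> Fr M z (Ap M m1 m2)).
Definition FrLm := @Property [:: lm; fr] (fun M => forall x m z,
  z = x \/ Fr M z m -> Fr M z (Lm M x m)).
Definition FvVr := @Property [:: vr; fv] (fun M => forall x,
  FV M (Vr M x) `<=` [set x]).
Definition FvAp := @Property [:: ap; fv] (fun M => forall m1 m2,
  FV M (Ap M m1 m2) `<=` FV M m1 `|` FV M m2).
Definition FvLm := @Property [:: lm; fv] (fun M => forall x m,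
  FV M (Lm M x m) `<=` FV M m `\ x).
Definition FvDPm := @Property [:: pm; fv] (fun M => forall m,
  FV M m = [set x | infinite_set [set y | Pm M m (transp x y) <> m]]).
Definition FvDSw := @Property [:: sw; fv] (fun M => forall m,
  FV M m = [set x | infinite_set [set y | Sw M m x y <> m]]).
Definition FCB := @Property [:: lm; fv] (fun M => exists x, forall m,
  x \notin FV M (Lm M x m)).

End Models.

Variant recursor_index := i1 | i2 | i3 | i4 | i5 | i6 | i7 | i8 | i9.

Definition props (Var : countType) (i : recursor_index) : seq (property Var) :=
  match i with
  | i1 => [:: PmVr Var; PmAp Var; PmLm Var; PmId Var; PmCp Var;
              FvDPm Var; FCB Var]
  | i2 => [:: PmVr Var; PmAp Var; PmLm Var; PmId Var; PmCp Var;
              PmFv Var; FvVr Var; FvAp Var; FvLm Var]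
  | i3 => [:: SwVr Var; SwAp Var; SwLm Var; SwId Var; SwIv Var; SwCp Var;
              FvDSw Var; FCB Var]
  | i4 => [:: SwVr Var; SwAp Var; SwLm Var; SwFv Var;
              FvVr Var; FvAp Var; FvLm Var]
  | i5 => [:: SwVr Var; SwAp Var; SwLm Var; SwBvr Var;
              FrVr Var; FrAp Var; FrLm Var]
  | i6 => [:: SwVr Var; SwAp Var; SwLm Var; SwCg Var;
              FrVr Var; FrAp Var; FrLm Var]
  | i7 => [:: SbVr Var; SbAp Var; SbLm Var; SbBvr Var;
              FrVr Var; FrAp Var; FrLm Var]
  | i8 => [:: RnVr Var; RnAp Var; RnLm1 Var; RnLm2 Var; RnBvr2 Var;
              RnId Var; RnIm Var; RnCh Var; RnCm Var]
  | i9 => [:: RnVr Var; RnAp Var; RnLm1 Var; RnBvr Var;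
              FrVr Var; FrAp Var; FrLm Var]
  end.

Definition Sig (Var : countType) (i : recursor_index) : signature :=
  signature_of (props Var i).

Lemma sig_ctor_sub (Var : countType) (i : recursor_index) :
  {subset sig_ctor <= Sig Var i}.
Proof. by apply/allP; case: i. Qed.

Definition ext_models (Var : countType) (i : recursor_index) : category :=
  models_sat (Sig Var i) (props Var i).

(* The tuple r_i, where Htr says that the term model is an object of the
   extended category. *)
Definition recursor (Var : countType) (i : recursor_index)
    (Htr : satisfies_all (term_model Var (Sig Var i)) (props Var i)) :
    recursor_tuple :=
  @RecursorTuple (models Var sig_ctor) (term_model Var sig_ctor)
    (ext_models Var i) (exist _ (term_model Var (Sig Var i)) Htr)
    (forgetful (props Var i) (@sig_ctor_sub Var i)).

(* Main.v *)
Require Import Defs.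
From mathcomp Require Import all_boot.
From mathcomp Require Import boolp classical_sets functions cardinality.
From mathcomp Require Import generic_quotient.

(* Every model M receives the structurally recursive map prec from preterms, and
   a morphism from the term model is determined by the constructors, so all
   that has to be shown is that prec identifies alpha-equivalent preterms and
   that the induced map trec preserves the remaining operations. Invariance
   only concerns the exchange of a bound variable x for a variable y that does
   not occur in its scope. Each swapping axiomatisation makes swapping commute
   with prec and yields freshness or support bounds that allow this exchange.
   For substitution and renaming one shows
   prec (p with x and y exchanged) = (prec p)[y/x] by induction on the size
   of p; in the purely equational axiomatisation of renaming, freshness of x
   for m is recovered as "renaming x in m has no effect". *)

Set Implicit Arguments.
Unset Strict Implicit.
Unset Printing Implicit Defensive.

Local Open Scope classical_set_scope.
Local Open Scope quotient_scope.

(** * Alpha-equivalence *)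

Section Preterms.
Variable Var : countType.
Implicit Types (x y z : Var) (p q : preterm Var) (s : Var -> Var).

Lemma swap_var_l x y : swap_var x y x = y.
Proof. by rewrite /swap_var eqxx. Qed.

Lemma swap_varC x y : swap_var x y = swap_var y x.
Proof.
apply/funext => z; rewrite /swap_var.
by have [->|//] := eqVneq z x; have [->|] := eqVneq x y.
Qed.

Lemma swap_var_r x y : swap_var x y y = x.
Proof. by rewrite swap_varC swap_var_l. Qed.

Lemma swap_var_id x y z : z <> x -> z <> y -> swap_var x y z = z.
Proof. by move=> /eqP/negbTE zx /eqP/negbTE zy; rewrite /swap_var zx zy. Qed.

Lemma swap_varxx x : swap_var x x = id.
Proof. by apply/funext => z; rewrite /swap_var; case: eqVneq. Qed.

Lemma swap_var_inj x y : injective (swap_var x y).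
Proof. exact: inv_inj (swap_varK x y). Qed.

Lemma swap_var_morph s x y z : injective s ->
  s (swap_var x y z) = swap_var (s x) (s y) (s z).
Proof. by move=> s_inj; rewrite /swap_var !(inj_eq s_inj); do 2?case: eqP. Qed.

Lemma perm_inj (s : perm Var) : injective s.
Proof. exact: bij_inj (perm_bij s). Qed.

Lemma perm_ext (s t : perm Var) : s =1 t -> s = t.
Proof.
case: s t => [s bs fs] [t bt ft] /= /funext st.
by case: _ / st in bt ft *; congr Perm; exact: Prop_irrelevance.
Qed.

Lemma pperm_comp s s' p : pperm s (pperm s' p) = pperm (s \o s') p.
Proof. by elim: p => //= [p -> q ->|x p ->]. Qed.

Lemma eq_in_pperm s s' p :
  (forall v, pvars p v -> s v = s' v) -> pperm s p = pperm s' p.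
Proof.
elim: p => //= [x|p IHp q IHq|x p IHp] ss'; first by rewrite ss'.
  by rewrite IHp ?IHq // => v pv; apply: ss'; [right|left].
by rewrite IHp ?ss' //; [left|move=> v pv; apply: ss'; right].
Qed.

Lemma pperm_id p : pperm id p = p.
Proof. by elim: p => //= [p -> q ->|x p ->]. Qed.

Lemma pvars_pperm s p : pvars (pperm s p) = s @` pvars p.
Proof.
elim: p => /= [x|p -> q ->|x p ->]; first by rewrite image_set1.
  by rewrite image_setU.
by rewrite image_setU image_set1.
Qed.

Lemma pFV_pvars p : pFV p `<=` pvars p.
Proof.
elim: p => /= [x|p IHp q IHq|x p IHp] //; first exact: setUSS.
by move=> y [/IHp]; right.
Qed.

Lemma finite_pvars p : finite_set (pvars p).
Proof.
elim: p => /= [x|p IHp q IHq|x p IHp]; first exact: finite_set1.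
  by rewrite finite_setU.
by rewrite finite_setU; split=> //; exact: finite_set1.
Qed.

Lemma finite_pFV p : finite_set (pFV p).
Proof. exact: sub_finite_set (@pFV_pvars p) (finite_pvars p). Qed.

Lemma pFV_pperm s p : injective s -> pFV (pperm s p) = s @` pFV p.
Proof.
move=> s_inj; elim: p => /= [x|p -> q ->|x p ->]; first by rewrite image_set1.
  by rewrite image_setU.
apply/seteqP; split=> [_ [[y py <-]] ysx|_ [y [py yx] <-]].
  by exists y => //; split=> // yx; apply: ysx; rewrite yx.
by split; [exists y|move=> /s_inj].
Qed.

Lemma alpha_pFV p q : alpha p q -> pFV p = pFV q.
Proof.
elim=> //=.
- by move=> p1 q1 r1 _ -> _ ->.
- by move=> p1 p2 q1 q2 _ -> _ ->.
- by move=> x p1 p2 _ ->.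
move=> x y p1 yp; rewrite pFV_pperm; last exact: swap_var_inj.
apply/seteqP; split=> [z [pz zx]|_ [[z pz <-]] zy].
  have zy : z <> y by move=> zy; apply: yp; rewrite -zy; exact: pFV_pvars.
  by split=> //; exists z => //; exact: swap_var_id.
have zx : z <> x by move=> zx; apply: zy; rewrite zx; exact: swap_var_l.
have zy' : z <> y by move=> zy'; apply: yp; rewrite -zy'; exact: pFV_pvars.
by rewrite swap_var_id.
Qed.

Lemma alpha_pperm s p q :
  injective s -> alpha p q -> alpha (pperm s p) (pperm s q).
Proof.
move=> s_inj; elim=> /= {p q}.
- by move=> p; exact: alpha_refl.
- by move=> p q _; exact: alpha_sym.
- by move=> p q r _ pq _; exact: alpha_trans pq.
- by move=> p p' q q' _ pp' _; exact: alpha_ap.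
- by move=> x p p' _; exact: alpha_lm.
move=> x y p yp.
have -> : pperm s (pperm (swap_var x y) p) =
          pperm (swap_var (s x) (s y)) (pperm s p).
  by rewrite !pperm_comp; apply: eq_in_pperm => v _; exact: swap_var_morph.
apply: alpha_bound; rewrite pvars_pperm => -[v pv /s_inj vy].
by rewrite -vy in yp.
Qed.

Hypothesis Var_inf : infinite_set [set: Var].

Lemma exists_fresh (A : set Var) : finite_set A -> exists z, ~ A z.
Proof.
move=> Afin; apply: contrapT => /forallNP NA; apply: Var_inf.
by apply: sub_finite_set Afin => z _; apply: contrapT; exact: NA.
Qed.

(** Under an abstraction, both bound variables are moved to a common [z] occurring in neither body.
    The composites of [s] and [s'] with these exchanges then agree at the bound variable too, so the
    induction has to range over all injective [s] and [s']. *)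
Lemma alpha_eq_in_pperm s s' p : injective s -> injective s' ->
  (forall v, pFV p v -> s v = s' v) -> alpha (pperm s p) (pperm s' p).
Proof.
elim: p s s' => /= [x|p IHp q IHq|x p IHp] s s' s_inj s'_inj ss'.
- by rewrite ss'//; exact: alpha_refl.
- apply: alpha_ap; [apply: IHp|apply: IHq] => // v pv; apply: ss'.
    by left.
  by right.
have [z /not_orP[zs zs']] : exists z,
    ~ (pvars (pperm s p) `|` pvars (pperm s' p)) z.
  by apply: exists_fresh; rewrite finite_setU; split; exact: finite_pvars.
apply: alpha_trans (alpha_bound (s x) zs) _; apply: alpha_sym.
apply: alpha_trans (alpha_bound (s' x) zs') _; apply: alpha_lm.
rewrite !pperm_comp; apply: IHp => [||v pv /=].
- exact: inj_comp (@swap_var_inj _ _) s'_inj.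
- exact: inj_comp (@swap_var_inj _ _) s_inj.
have pv' := pFV_pvars pv.
have [->|/eqP vx] := eqVneq v x; first by rewrite !swap_var_l.
have ss'v : s v = s' v by exact: ss'.
(* For [v] other than [x], injectivity keeps the images of [v] and [x] apart and the choice of [z]
   excludes [z], so neither exchange acts. *)
rewrite (swap_var_id (z := s v)) ?(swap_var_id (z := s' v)) ?ss'v //.
- by move/s'_inj.
- by move=> vz; apply: zs'; rewrite pvars_pperm; exists v.
- by rewrite -ss'v => /s_inj.
- by move=> vz; apply: zs; rewrite pvars_pperm; exists v; rewrite // ss'v.
Qed.

Lemma alpha_pperm_id s p : injective s ->
  (forall v, pFV p v -> s v = v) -> alpha (pperm s p) p.
Proof.
by move=> s_inj sp; rewrite -[X in alpha _ X]pperm_id; exact: alpha_eq_in_pperm.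
Qed.

(** Strengthens [alpha_bound], as [y] may now occur bound in [p]. Both abstractions are moved to a
    variable [z] that occurs in neither body; the resulting permutations of [p] agree on its free
    variables. *)
Lemma alpha_bound_pFV x y p : ~ pFV p y ->
  alpha (PLm x p) (PLm y (pperm (swap_var x y) p)).
Proof.
move=> yp; have [z /not_orP[zp zq]] : exists z,
    ~ (pvars p `|` pvars (pperm (swap_var x y) p)) z.
  by apply: exists_fresh; rewrite finite_setU; split; exact: finite_pvars.
apply: alpha_trans (alpha_bound x zp) _; apply: alpha_sym.
apply: alpha_trans (alpha_bound y zq) _; apply: alpha_lm.
rewrite pperm_comp; apply: alpha_eq_in_pperm => [||v pv /=].
- exact: inj_comp (@swap_var_inj _ _) (@swap_var_inj _ _).
- exact: swap_var_inj.
have [->|/eqP vx] := eqVneq v x; first by rewrite !swap_var_l.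
have vz : v <> z by move=> vz; apply: zp; rewrite -vz; exact: pFV_pvars.
have vy : v <> y by move=> vy; apply: yp; rewrite -vy.
by rewrite !(@swap_var_id _ _ v).
Qed.

End Preterms.

(** * Substitution on preterms *)

Definition update (Var : countType) (T : Type) (r : Var -> T) (x : Var) (t : T)
  : Var -> T := fun y => if y == x then t else r y.

Section PretermSubstitution.
Variable Var : countType.
Hypothesis Var_inf : infinite_set [set: Var].
Implicit Types (x y z : Var) (p q : preterm Var) (r : Var -> preterm Var).

Lemma update_eq T (r : Var -> T) x t : update r x t x = t.
Proof. by rewrite /update eqxx. Qed.

Lemma update_neq T (r : Var -> T) x t y : y <> x -> update r x t y = r y.
Proof. by move=> /eqP/negbTE yx; rewrite /update yx. Qed.

Lemma psubst_lm r x p :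
  let x' := fresh x (\bigcup_(y in pFV p `\ x) pFV (r y)) in
  psubst r (PLm x p) = PLm x' (psubst (update r x (PVr x')) p).
Proof. by []. Qed.

Lemma fresh_notin x (A : set Var) : finite_set A -> ~ A (fresh x A).
Proof. by move=> Afin; apply: (@xgetPex _ x (~` A)); exact: exists_fresh. Qed.

Lemma finite_bigcup_pFV r (A : set Var) : finite_set A ->
  finite_set (\bigcup_(y in A) pFV (r y)).
Proof. by move=> Afin; apply: bigcup_finite => // y _; exact: finite_pFV. Qed.

Lemma finite_pFV_lm r x p : finite_set (\bigcup_(y in pFV p `\ x) pFV (r y)).
Proof. exact: (@finite_bigcup_pFV r (pFV (PLm x p)) (finite_pFV _)). Qed.

Lemma alpha_psubst_ext r r' p : (forall v, pFV p v -> alpha (r v) (r' v)) ->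
  alpha (psubst r p) (psubst r' p).
Proof.
elim: p r r' => [x|p IHp q IHq|x p IHp] r r' rr'.
- exact: rr'.
- by apply: alpha_ap; [apply: IHp|apply: IHq] => v pv; apply: rr';
    [left|right].
rewrite !psubst_lm /=.
(* The new bound variable depends on [r] only through this set, so both substitutions choose the
   same one. *)
rewrite (_ : \bigcup_(y in pFV p `\ x) pFV (r y) =
             \bigcup_(y in pFV p `\ x) pFV (r' y)).
  apply/alpha_lm/IHp => v pv; rewrite /update.
  by have [_|/eqP vx] := eqVneq v x; [exact: alpha_refl|exact: rr'].
by apply: eq_bigcupr => v pv; apply: alpha_pFV; exact: rr'.
Qed.

Lemma pFV_psubst r p : pFV (psubst r p) `<=` \bigcup_(y in pFV p) pFV (r y).
Proof.
elim: p r => [x|p IHp q IHq|x p IHp] r.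
- by rewrite /= bigcup_set1.
- by rewrite /= bigcup_setU; exact: setUSS.
rewrite psubst_lm /= => z [/IHp[y py]].
have [->|/eqP yx] := eqVneq y x; first by rewrite update_eq.
by rewrite update_neq // => zy _; exists y.
Qed.

(** The choice of the new bound variable is immaterial: exchanging [z1] and [z2] leaves each [r y]
    alone up to [alpha], as neither is free there. Equivariance is a hypothesis because this lemma
    serves inside the induction that proves it. *)
Lemma alpha_psubst_lm_aux r x p z1 z2 :
  (forall r s, injective s ->
    alpha (pperm s (psubst r p)) (psubst (pperm s \o r) p)) ->
  ~ (\bigcup_(y in pFV p `\ x) pFV (r y)) z1 ->
  ~ (\bigcup_(y in pFV p `\ x) pFV (r y)) z2 ->
  alpha (PLm z1 (psubst (update r x (PVr z1)) p))
        (PLm z2 (psubst (update r x (PVr z2)) p)).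
Proof.
move=> equiv rz1 rz2.
have [<-|/eqP z12] := eqVneq z1 z2; first exact: alpha_refl.
apply: alpha_trans (alpha_bound_pFV Var_inf (y := z2) z1 _) _.
  move=> /pFV_psubst[y py].
  have [->|/eqP yx] := eqVneq y x; first by rewrite update_eq => /esym.
  by rewrite update_neq // => yz2; apply: rz2; exists y.
apply: alpha_lm; apply: alpha_trans (equiv _ _ (@swap_var_inj _ _ _)) _.
apply: alpha_psubst_ext => y py /=.
have [->|/eqP yx] := eqVneq y x.
  by rewrite !update_eq /= swap_var_l; exact: alpha_refl.
rewrite !update_neq //; apply: alpha_pperm_id => //; first exact: swap_var_inj.
move=> v yv; apply: swap_var_id => vz.
  by apply: rz1; exists y => //; rewrite -vz.
by apply: rz2; exists y => //; rewrite -vz.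
Qed.

(** Equality holds only up to [alpha], since [fresh] need not commute with [s]; the two choices are
    reconciled by [alpha_psubst_lm_aux]. *)
Lemma alpha_pperm_psubst r s p : injective s ->
  alpha (pperm s (psubst r p)) (psubst (pperm s \o r) p).
Proof.
elim: p r s => [x|p IHp q IHq|x p IHp] r s s_inj.
- exact: alpha_refl.
- by apply: alpha_ap; [exact: IHp|exact: IHq].
rewrite !psubst_lm /=; set x' := fresh x _; set x'' := fresh x _.
have /alpha_lm/alpha_trans := IHp (update r x (PVr x')) s s_inj; apply.
rewrite (_ : _ \o _ = update (pperm s \o r) x (PVr (s x'))).
  apply: alpha_psubst_lm_aux => //; last exact/fresh_notin/finite_pFV_lm.
  (* Freshness of [s x'] for the permuted images comes from freshness of [x'] for the original
     ones. *)
  move=> -[y py]; rewrite /= pFV_pperm // => -[v yv /s_inj vx'].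
  apply: (fresh_notin (x := x) (finite_pFV_lm r x p)); exists y => //.
  by rewrite -/x' -vx'.
by apply/funext => y; rewrite /= /update; case: eqP.
Qed.

Lemma alpha_psubst_lm r x p z :
  ~ (\bigcup_(y in pFV p `\ x) pFV (r y)) z ->
  alpha (psubst r (PLm x p)) (PLm z (psubst (update r x (PVr z)) p)).
Proof.
move=> rz; rewrite psubst_lm; apply: alpha_psubst_lm_aux => //.
  by move=> *; exact: alpha_pperm_psubst.
exact/fresh_notin/finite_pFV_lm.
Qed.

Lemma alpha_psubst_pperm r s p : injective s ->
  alpha (psubst r (pperm s p)) (psubst (r \o s) p).
Proof.
elim: p r => [x|p IHp q IHq|x p IHp] r s_inj.
- exact: alpha_refl.
- by apply: alpha_ap; [exact: IHp|exact: IHq].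
(* The variable chosen for the permuted abstraction is admissible for the original one as well, so
   it serves on both sides. *)
rewrite psubst_lm /=; set x' := fresh _ _; apply: alpha_sym.
apply: alpha_trans (alpha_psubst_lm (z := x') _) _.
  move=> [y [py yx]] /= yx'.
  apply: (fresh_notin (x := s x) (finite_pFV_lm r (s x) (pperm s p))).
  exists (s y) => //; split; last by move/s_inj.
  by rewrite pFV_pperm //; exists y.
apply/alpha_lm/alpha_sym; apply: alpha_trans (IHp _ s_inj) _.
apply: alpha_psubst_ext => y py /=; rewrite /update (inj_eq s_inj).
exact: alpha_refl.
Qed.

(** In the [alpha_bound] case both results are brought to the same bound variable [z], and
    [alpha_psubst_pperm] absorbs the exchange of [x] and [y] into the substitution. *)
Lemma alpha_psubst r p q : alpha p q -> alpha (psubst r p) (psubst r q).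
Proof.
move=> pq; elim: pq r => {p q} [p r|p q _ IH r|p q s _ IH1 _ IH2 r
  |p p' q q' _ IH1 _ IH2 r|x p p' pp' IH r|x y p yp r].
- exact: alpha_refl.
- exact/alpha_sym/IH.
- exact: alpha_trans (IH1 r) (IH2 r).
- exact: alpha_ap (IH1 r) (IH2 r).
- by rewrite !psubst_lm /= (alpha_pFV pp'); exact/alpha_lm/IH.
have [z rz] := exists_fresh Var_inf (finite_pFV_lm r x p).
apply: alpha_trans (alpha_psubst_lm rz) _; apply: alpha_sym.
apply: alpha_trans (alpha_psubst_lm (z := z) _) _.
  (* The two abstractions have the same free variables, so [z] is admissible for the second one
     too. *)
  by move: rz; have /= -> := alpha_pFV (alpha_bound x yp).
apply: alpha_lm; apply: alpha_trans (alpha_psubst_pperm _ _ _) _.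
  exact: swap_var_inj.
apply: alpha_psubst_ext => v pv /=.
have [->|/eqP vx] := eqVneq v x.
  by rewrite swap_var_l !update_eq; exact: alpha_refl.
have vy : v <> y by move=> vy; apply: yp; rewrite -vy; exact: pFV_pvars.
by rewrite swap_var_id // !update_neq //; exact: alpha_refl.
Qed.

End PretermSubstitution.

(** * Operations on terms *)

Section Terms.
Variable Var : countType.
Implicit Types (x y z : Var) (p q : preterm Var) (t u : term Var).
Implicit Types (s : perm Var) (r : Var -> term Var).

Lemma pi_alphaP p q : \pi_(term Var) p = \pi_(term Var) q <-> alpha p q.
Proof.
split=> [/eqP|pq]; first by rewrite eqmodE => /asboolP.
by apply/eqP; rewrite eqmodE; apply/asboolP.
Qed.

Lemma alpha_repr_pi p : alpha (repr (\pi_(term Var) p)) p.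
Proof. by apply/pi_alphaP; rewrite reprK. Qed.

Lemma pi_Ap p q :
  \pi_(term Var) (PAp p q) = Ap (\pi_(term Var) p) (\pi_(term Var) q).
Proof. by apply/pi_alphaP/alpha_ap; apply/alpha_sym/alpha_repr_pi. Qed.

Lemma pi_Lm x p : \pi_(term Var) (PLm x p) = Lm x (\pi_(term Var) p).
Proof. by apply/pi_alphaP/alpha_lm/alpha_sym/alpha_repr_pi. Qed.

Lemma term_ind (P : term Var -> Prop) :
  (forall x, P (Vr x)) ->
  (forall t u, P t -> P u -> P (Ap t u)) ->
  (forall x t, P t -> P (Lm x t)) ->
  forall t, P t.
Proof.
move=> PVr PAp PLm t; rewrite -[t]reprK.
elim: (repr t) => [x|p IHp q IHq|x p IHp]; first exact: PVr.
  by rewrite pi_Ap; exact: PAp.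
by rewrite pi_Lm; exact: PLm.
Qed.

Lemma FV_pi p : FV_term (\pi_(term Var) p) = pFV p.
Proof. exact/alpha_pFV/alpha_repr_pi. Qed.

Lemma FV_Vr x : FV_term (Vr x) = [set x].
Proof. by rewrite FV_pi. Qed.

Lemma FV_Ap t u : FV_term (Ap t u) = FV_term t `|` FV_term u.
Proof. by rewrite FV_pi. Qed.

Lemma FV_Lm x t : FV_term (Lm x t) = FV_term t `\ x.
Proof. by rewrite FV_pi. Qed.

Lemma finite_FV t : finite_set (FV_term t).
Proof. exact: finite_pFV. Qed.

Lemma perm_pi p s : perm_term (\pi_(term Var) p) s = \pi_(term Var) (pperm s p).
Proof. exact/pi_alphaP/alpha_pperm/alpha_repr_pi/perm_inj. Qed.

Lemma perm_Vr x s : perm_term (Vr x) s = Vr (s x).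
Proof. by rewrite perm_pi. Qed.

Lemma perm_Ap t u s :
  perm_term (Ap t u) s = Ap (perm_term t s) (perm_term u s).
Proof. by rewrite perm_pi /= pi_Ap. Qed.

Lemma perm_Lm x t s : perm_term (Lm x t) s = Lm (s x) (perm_term t s).
Proof. by rewrite perm_pi /= pi_Lm. Qed.

Lemma perm_id t : perm_term t (id_perm Var) = t.
Proof. by rewrite /perm_term pperm_id reprK. Qed.

Lemma perm_comp t s s' :
  perm_term (perm_term t s) s' = perm_term t (comp_perm s' s).
Proof. by rewrite [perm_term t s]/perm_term perm_pi pperm_comp. Qed.

Lemma FV_perm t s : FV_term (perm_term t s) = s @` FV_term t.
Proof. by rewrite FV_pi pFV_pperm //; exact: perm_inj. Qed.

(** Unlike single substitutions, parallel ones compose, so that chains of renamings become one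
    substitution; [subst_term] and [ren_term] are instances. *)
Definition tsubst r t : term Var :=
  \pi_(term Var) (psubst (repr \o r) (repr t)).

Hypothesis Var_inf : infinite_set [set: Var].

Lemma perm_fix t s : (forall v, FV_term t v -> s v = v) -> perm_term t s = t.
Proof.
move=> st; rewrite -[RHS]reprK; apply/pi_alphaP.
by apply: alpha_pperm_id => //; exact: perm_inj.
Qed.

Lemma swap_fix t x y : ~ FV_term t x -> ~ FV_term t y -> swap_term t x y = t.
Proof.
move=> tx ty; apply: perm_fix => v tv /=; apply: swap_var_id => vz.
  by apply: tx; rewrite -vz.
by apply: ty; rewrite -vz.
Qed.

Lemma Lm_swap x y t : ~ FV_term t y -> Lm x t = Lm y (swap_term t x y).
Proof. by move=> ty; rewrite -pi_Lm; exact/pi_alphaP/alpha_bound_pFV. Qed.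

Lemma swap_termC t x y : swap_term t x y = swap_term t y x.
Proof.
by congr perm_term; apply: perm_ext => z /=; rewrite swap_varC.
Qed.

Lemma tsubst_pi r p : tsubst r (\pi_(term Var) p) =
  \pi_(term Var) (psubst (repr \o r) p).
Proof. exact/pi_alphaP/alpha_psubst/alpha_repr_pi. Qed.

Lemma tsubst_Vr r x : tsubst r (Vr x) = r x.
Proof. by rewrite tsubst_pi /= reprK. Qed.

Lemma tsubst_Ap r t u : tsubst r (Ap t u) = Ap (tsubst r t) (tsubst r u).
Proof. by rewrite tsubst_pi /= pi_Ap. Qed.

Lemma tsubst_Lm r x t z :
  ~ (\bigcup_(y in FV_term (Lm x t)) FV_term (r y)) z ->
  tsubst r (Lm x t) = Lm z (tsubst (update r x (Vr z)) t).
Proof.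
rewrite FV_Lm => rz; rewrite tsubst_pi -pi_Lm; apply/pi_alphaP.
apply: alpha_trans (alpha_psubst_lm Var_inf (z := z) rz) _; apply: alpha_lm.
apply: alpha_psubst_ext => v _; rewrite /update /=.
by case: eqP => _; [exact/alpha_sym/alpha_repr_pi|exact: alpha_refl].
Qed.

Lemma eq_in_tsubst r r' t : (forall v, FV_term t v -> r v = r' v) ->
  tsubst r t = tsubst r' t.
Proof.
move=> rr'; apply/pi_alphaP/alpha_psubst_ext => v tv /=.
by rewrite rr' //; exact: alpha_refl.
Qed.

Lemma FV_tsubst r t :
  FV_term (tsubst r t) `<=` \bigcup_(y in FV_term t) FV_term (r y).
Proof. by rewrite FV_pi; exact: pFV_psubst. Qed.

Lemma tsubst_id t : tsubst (@Vr Var) t = t.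
Proof.
elim/term_ind: t => [x|t u IHt IHu|x t IHt].
- by rewrite tsubst_Vr.
- by rewrite tsubst_Ap IHt IHu.
rewrite (tsubst_Lm (z := x)); last first.
  by rewrite FV_Lm => -[y [ty yx]]; rewrite FV_Vr => /esym.
congr Lm; rewrite -[RHS]IHt; apply: eq_in_tsubst => v _.
by rewrite /update; case: eqP => [->|].
Qed.

Lemma tsubst_fix r t : (forall v, FV_term t v -> r v = Vr v) -> tsubst r t = t.
Proof. by move=> rt; rewrite -[RHS]tsubst_id; exact: eq_in_tsubst. Qed.

Lemma finite_FV_bigcup r t :
  finite_set (\bigcup_(y in FV_term t) FV_term (r y)).
Proof. by apply: bigcup_finite => [|y _]; exact: finite_FV. Qed.

Lemma tsubst_comp r r' t : tsubst r (tsubst r' t) = tsubst (tsubst r \o r') t.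
Proof.
elim/term_ind: t r r' => [x|t u IHt IHu|x t IHt] r r'.
- by rewrite !tsubst_Vr.
- by rewrite !tsubst_Ap IHt IHu.
(* The variable [z] serves for the inner substitution; the later [w] serves for the outer one and
   the composite at once. *)
have [z r'z] := exists_fresh Var_inf (finite_FV_bigcup r' (Lm x t)).
rewrite (tsubst_Lm r'z); set t' := tsubst _ t.
have [w] : exists w, ~ (\bigcup_(y in FV_term (Lm z t')) FV_term (r y) `|`
    \bigcup_(y in FV_term (Lm x t)) FV_term ((tsubst r \o r') y)) w.
  apply: exists_fresh => //.
  by rewrite finite_setU; split; exact: finite_FV_bigcup.
move=> /not_orP[rw r'w]; rewrite (tsubst_Lm rw) (tsubst_Lm r'w); congr Lm.
rewrite /t' IHt; apply: eq_in_tsubst => v tv /=.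
have [->|/eqP vx] := eqVneq v x.
  by rewrite !update_eq tsubst_Vr update_eq.
(* As [z] is not free in [r' v], the update of [r] at [z] is not seen there. *)
rewrite !update_neq //; apply: eq_in_tsubst => v' r'v'.
rewrite update_neq // => v'z.
by apply: r'z; exists v; rewrite ?FV_Lm // -v'z.
Qed.

Lemma subst_termE t u x : subst_term t u x = tsubst (update (@Vr Var) x u) t.
Proof.
apply/pi_alphaP/alpha_psubst_ext => v _; rewrite /update /=.
by case: eqP => _; [exact: alpha_refl|exact/alpha_sym/alpha_repr_pi].
Qed.

Lemma ren_termE t y x : ren_term t y x = tsubst (@Vr Var \o ren_var y x) t.
Proof.
rewrite /ren_term subst_termE; apply: eq_in_tsubst => v _.
by rewrite /update /ren_var /=; case: eqP.
Qed.

Lemma subst_Vr x u z : subst_term (Vr x) u z = if x == z then u else Vr x.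
Proof. by rewrite subst_termE tsubst_Vr. Qed.

Lemma subst_Ap t1 t2 u z :
  subst_term (Ap t1 t2) u z = Ap (subst_term t1 u z) (subst_term t2 u z).
Proof. by rewrite !subst_termE tsubst_Ap. Qed.

Lemma ren_Vr x y z : ren_term (Vr x) y z = Vr (ren_var y z x).
Proof. by rewrite ren_termE tsubst_Vr. Qed.

Lemma ren_Ap t u y z :
  ren_term (Ap t u) y z = Ap (ren_term t y z) (ren_term u y z).
Proof. exact: subst_Ap. Qed.

Lemma subst_Lm x t u z : x <> z -> ~ FV_term u x ->
  subst_term (Lm x t) u z = Lm x (subst_term t u z).
Proof.
move=> xz ux; rewrite !subst_termE (tsubst_Lm (z := x)).
  congr Lm; apply: eq_in_tsubst => v _; rewrite /update.
  by case: eqP => // ->; case: eqP.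
rewrite FV_Lm => -[v [tv vx]]; rewrite /update; case: eqP => // _.
by rewrite FV_Vr => /esym.
Qed.

Lemma Lm_subst x y t : ~ FV_term t y -> Lm x t = Lm y (subst_term t (Vr y) x).
Proof.
move=> ty; rewrite subst_termE -tsubst_Lm ?tsubst_id // FV_Lm => -[v [tv _]].
by rewrite FV_Vr => yv; apply: ty; rewrite yv.
Qed.

Lemma ren_Lm x t y z : x <> y -> x <> z ->
  ren_term (Lm x t) y z = Lm x (ren_term t y z).
Proof. by move=> xy xz; apply: subst_Lm => //; rewrite FV_Vr. Qed.

Lemma ren_fix t y x : ~ FV_term t x -> ren_term t y x = t.
Proof.
move=> tx; rewrite ren_termE; apply: tsubst_fix => v tv /=.
by rewrite /ren_var; case: eqP => // vx; case: tx; rewrite -vx.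
Qed.

Lemma FV_ren t y x : FV_term (ren_term t y x) `<=` ren_var y x @` FV_term t.
Proof.
rewrite ren_termE; move=> z /FV_tsubst[v tv] /=; rewrite FV_Vr => ->.
by exists v.
Qed.

Lemma ren_notin t y x : y <> x -> ~ FV_term (ren_term t y x) x.
Proof. by move=> yx /FV_ren[v _]; rewrite /ren_var; case: eqP. Qed.

(** Reduces identities between iterated renamings to identities between functions on variables. *)
Lemma ren_ren t y x y' x' : ren_term (ren_term t y x) y' x' =
  tsubst (@Vr Var \o (ren_var y' x' \o ren_var y x)) t.
Proof.
rewrite !ren_termE tsubst_comp; apply: eq_in_tsubst => v _ /=.
by rewrite tsubst_Vr.
Qed.

End Terms.

(** * Recursion into a model *)

Section Recursion.
Variable Var : countType.
Hypothesis Var_inf : infinite_set [set: Var].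
Implicit Types (x y z : Var) (p q : preterm Var) (t u : term Var).

Lemma exists_neq2 x y : exists z, z <> x /\ z <> y.
Proof.
have [z /not_orP[zx zy]] := exists_fresh Var_inf (finite_set2 x y).
by exists z.
Qed.

(** Barendregt's variable convention, which provides the side conditions of the abstraction clauses
    for renaming and substitution. *)
Lemma term_fresh_ind (A : set Var) (P : term Var -> Prop) : finite_set A ->
  (forall x, P (Vr x)) ->
  (forall t u, P t -> P u -> P (Ap t u)) ->
  (forall x t, ~ A x -> P t -> P (Lm x t)) ->
  forall t, P t.
Proof.
move=> Afin PVr PAp PLm t.
(* Strengthened to all permuted copies of t, so that the induction hypothesis
   covers the body after its bound variable has been moved out of A. *)
rewrite -[t]perm_id; move: (id_perm Var).
elim/term_ind: t => [x|t u IHt IHu|x t IHt] s.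
- by rewrite perm_Vr.
- by rewrite perm_Ap; exact: PAp.
have [z] : exists z, ~ (A `|` FV_term (perm_term t s)) z.
  apply: exists_fresh => //.
  by rewrite finite_setU; split=> //; exact: finite_FV.
move=> /not_orP[Az tz]; rewrite perm_Lm (Lm_swap Var_inf (s x) tz).
by apply: PLm => //; rewrite /swap_term perm_comp.
Qed.

Variables (M : Type) (vrM : Var -> M) (apM : M -> M -> M) (lmM : Var -> M -> M).

Fixpoint prec p : M :=
  match p with
  | PVr x => vrM x
  | PAp p q => apM (prec p) (prec q)
  | PLm x p => lmM x (prec p)
  end.

Definition trec t : M := prec (repr t).

(** Here [f] stands for the action of [s] on the model, be it by permutation or by swapping. *)
Lemma prec_pperm (s : Var -> Var) (f : M -> M) p :
  (forall x, f (vrM x) = vrM (s x)) ->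
  (forall m n, f (apM m n) = apM (f m) (f n)) ->
  (forall x m, f (lmM x m) = lmM (s x) (f m)) ->
  prec (pperm s p) = f (prec p).
Proof.
move=> fV fA fL; elim: p => /= [x|p -> q ->|x p ->]; by rewrite ?fV ?fA ?fL.
Qed.

(** * Descent of the recursive map to terms *)

Section Invariance.

Hypothesis prec_bound : forall x y p, y <> x -> ~ pvars p y ->
  lmM x (prec p) = lmM y (prec (pperm (swap_var x y) p)).

Lemma prec_alpha p q : alpha p q -> prec p = prec q.
Proof.
elim=> //= {p q}.
- by move=> p q r _ -> _ ->.
- by move=> p p' q q' _ -> _ ->.
- by move=> x p p' _ ->.
(* Bound-variable axioms such as [SwBvr] concern distinct variables; for [y = x] the exchange is the
   identity. *)
move=> x y p yp; have [->|/eqP yx] := eqVneq y x; last exact: prec_bound.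
by rewrite swap_varxx pperm_id.
Qed.

Lemma trec_pi p : trec (\pi_(term Var) p) = prec p.
Proof. exact/prec_alpha/alpha_repr_pi. Qed.

Lemma trec_Vr x : trec (Vr x) = vrM x.
Proof. by rewrite trec_pi. Qed.

Lemma trec_Ap t u : trec (Ap t u) = apM (trec t) (trec u).
Proof. by rewrite trec_pi. Qed.

Lemma trec_Lm x t : trec (Lm x t) = lmM x (trec t).
Proof. by rewrite trec_pi. Qed.

Lemma trec_perm (s : perm Var) (f : M -> M) t :
  (forall x, f (vrM x) = vrM (s x)) ->
  (forall m n, f (apM m n) = apM (f m) (f n)) ->
  (forall x m, f (lmM x m) = lmM (s x) (f m)) ->
  trec (perm_term t s) = f (trec t).
Proof. by move=> fV fA fL; rewrite trec_pi; exact: prec_pperm. Qed.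

End Invariance.

Section Freshness.
(** A predicate rather than a boolean relation, so that it covers both the [fr] of a model and the
    freshness defined from renaming. *)
Variable frM : Var -> M -> Prop.
Hypothesis frVr : forall x z, z <> x -> frM z (vrM x).
Hypothesis frAp : forall m n z, frM z m -> frM z n -> frM z (apM m n).
Hypothesis frLm : forall x m z, z = x \/ frM z m -> frM z (lmM x m).

Lemma prec_fr z p : ~ pFV p z -> frM z (prec p).
Proof.
elim: p => /= [x|p IHp q IHq|x p IHp].
- exact: frVr.
- by move=> /not_orP[/IHp pz /IHq qz]; exact: frAp.
move=> pxz; apply: frLm; have [zx|zx] := pselect (z = x); first by left.
by right; apply: IHp => pz; apply: pxz.
Qed.

(** * Models with renaming and freshness *)

Section RenamingFresh.
Variable renM : M -> Var -> Var -> M.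
Hypothesis renVr : forall x y z, renM (vrM x) y z = vrM (ren_var y z x).
Hypothesis renAp : forall m n y z,
  renM (apM m n) y z = apM (renM m y z) (renM n y z).
Hypothesis renLm : forall x m y z, x <> y -> x <> z ->
  renM (lmM x m) y z = lmM x (renM m y z).
Hypothesis renBvr : forall m x x', x' <> x -> frM x' m ->
  lmM x m = lmM x' (renM m x' x).

(** The measure for [prec_ren]: a permuted body is not a subterm, but its size is unchanged. *)
Fixpoint psize p : nat :=
  match p with
  | PVr _ => 0
  | PAp p q => (psize p + psize q).+1
  | PLm _ p => (psize p).+1
  end.

Lemma psize_pperm s p : psize (pperm s p) = psize p.
Proof. by elim: p => //= [p -> q ->|x p ->]. Qed.

(** As [y] does not occur in [p], an abstraction in [p] can violate the side conditions of [renLm]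
    only by binding [x]. *)
Lemma prec_ren x y p : y <> x -> ~ pvars p y ->
  prec (pperm (swap_var x y) p) = renM (prec p) y x.
Proof.
move=> yx; move: {2}(psize p).+1 (ltnSn (psize p)) => n.
elim: n x y p yx => // n IH x y [v|p q|w q] yx /=.
- by move=> _ /nesym vy; rewrite renVr /swap_var /ren_var (introF eqP vy).
- rewrite ltnS => pqn /not_orP[py qy].
  rewrite renAp !IH // ?(leq_ltn_trans _ pqn) ?leq_addr ?leq_addl //.
rewrite ltnS => qn /not_orP[/nesym wy qy].
have [wx|/eqP wx] := eqVneq w x; last by rewrite renLm // swap_var_id ?IH.
(* Here x itself is bound: the abstraction is first moved to a third variable
   z, and the induction hypothesis is used on the renamed body. *)
subst w; rewrite swap_var_l IH // -renBvr //; last first.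
  by apply: prec_fr => /pFV_pvars.
(* It remains to see that renaming [x] has no effect on an abstraction over [x]. *)
have [z /not_orP[qz /not_orP[zx zy]]] : exists z, ~ (pvars q `|` [set x; y]) z.
  apply: exists_fresh => //.
  by rewrite finite_setU; split; [exact: finite_pvars|exact: finite_set2].
rewrite (renBvr zx); last by apply: prec_fr => /pFV_pvars.
have q'y : ~ pvars (pperm (swap_var x z) q) y.
  rewrite pvars_pperm => -[v qv vy]; apply: qy.
  by rewrite -(swap_var_id yx (nesym zy)) -vy swap_varK.
have q'x : ~ pvars (pperm (swap_var x z) q) x.
  rewrite pvars_pperm => -[v qv vx]; apply: qz.
  by rewrite -[z](swap_var_l x) -[X in swap_var _ _ X]vx swap_varK.
(* The renaming now passes below [z], where it amounts to exchanging [x] and [y] in a body that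
   contains neither. *)
rewrite -IH // (renLm _ zy zx).
rewrite -IH ?psize_pperm //; congr (lmM _ (prec _)).
rewrite -[LHS]pperm_id; apply: eq_in_pperm => v q'v; rewrite swap_var_id //.
  by move=> vx; rewrite vx in q'v.
by move=> vy; rewrite vy in q'v.
Qed.

Lemma prec_bound_ren x y p : y <> x -> ~ pvars p y ->
  lmM x (prec p) = lmM y (prec (pperm (swap_var x y) p)).
Proof.
move=> yx py; rewrite prec_ren // -renBvr //; apply: prec_fr.
by move=> /pFV_pvars.
Qed.

Lemma trec_ren t y z : trec (ren_term t y z) = renM (trec t) y z.
Proof.
have bound := prec_bound_ren; move: t.
apply: (term_fresh_ind (finite_set2 y z)).
- by move=> x; rewrite ren_Vr // !trec_Vr // renVr.
- move=> t u IHt IHu.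
  by rewrite ren_Ap // !trec_Ap // renAp IHt IHu.
move=> x t /not_orP[xy xz] IHt.
by rewrite ren_Lm // !trec_Lm // renLm // IHt.
Qed.

End RenamingFresh.

(** * Models with substitution and freshness *)

Section SubstitutionFresh.
Variable sbM : M -> M -> Var -> M.
Hypothesis sbVr : forall x n z, sbM (vrM x) n z = if x == z then n else vrM x.
Hypothesis sbAp : forall m1 m2 n z,
  sbM (apM m1 m2) n z = apM (sbM m1 n z) (sbM m2 n z).
Hypothesis sbLm : forall x m n z, x <> z -> frM x n ->
  sbM (lmM x m) n z = lmM x (sbM m n z).
Hypothesis sbBvr : forall m x x', x' <> x -> frM x' m ->
  lmM x m = lmM x' (sbM m (vrM x') x).

(** Substituting variables only is a renaming operation, and the freshness condition of [sbLm] then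
    becomes an inequality of variables through [frVr]. *)
Lemma prec_bound_sb x y p : y <> x -> ~ pvars p y ->
  lmM x (prec p) = lmM y (prec (pperm (swap_var x y) p)).
Proof.
apply: (@prec_bound_ren (fun m y x => sbM m (vrM y) x)) => //.
- by move=> v y' z; rewrite sbVr /ren_var; case: eqP.
- by move=> *; exact: sbLm (frVr _).
Qed.

Lemma trec_subst t u z : trec (subst_term t u z) = sbM (trec t) (trec u) z.
Proof.
have bound := prec_bound_sb; move: t.
have fin : finite_set (z |` FV_term u).
  by rewrite finite_setU; split; [exact: finite_set1|exact: finite_FV].
apply: (term_fresh_ind fin) => [x|t1 t2 IH1 IH2|x t].
- by rewrite subst_Vr // trec_Vr // sbVr; case: eqP; rewrite ?trec_Vr.
- by rewrite subst_Ap // !trec_Ap // sbAp IH1 IH2.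
move=> /not_orP[xz ux] IHt; rewrite subst_Lm // !trec_Lm // sbLm ?IHt //.
(* The side condition of [sbLm] in the model: [x] is not free in [u], hence fresh for [trec u]. *)
exact: prec_fr.
Qed.

End SubstitutionFresh.

(** * Models with swapping and freshness *)

Section Swapping.
Variable swM : M -> Var -> Var -> M.
Hypothesis swVr : forall x z1 z2,
  swM (vrM x) z1 z2 = vrM (swap_var z1 z2 x).
Hypothesis swAp : forall m1 m2 z1 z2,
  swM (apM m1 m2) z1 z2 = apM (swM m1 z1 z2) (swM m2 z1 z2).
Hypothesis swLm : forall x m z1 z2,
  swM (lmM x m) z1 z2 = lmM (swap_var z1 z2 x) (swM m z1 z2).

Lemma prec_swap p x y : prec (pperm (swap_var x y) p) = swM (prec p) x y.
Proof. exact: (@prec_pperm _ (fun m => swM m x y)). Qed.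

Lemma prec_bound_swap_fresh :
  (forall m x x', x' <> x -> frM x' m -> lmM x m = lmM x' (swM m x' x)) ->
  forall x y p, y <> x -> ~ pvars p y ->
  lmM x (prec p) = lmM y (prec (pperm (swap_var x y) p)).
Proof.
move=> swBvr x y p yx py; rewrite swap_varC prec_swap; apply: swBvr => //.
by apply: prec_fr => /pFV_pvars.
Qed.

Lemma prec_bound_swap_cg :
  (forall m1 m2 x1 x2 z, z <> x1 -> z <> x2 -> frM z m1 -> frM z m2 ->
    swM m1 z x1 = swM m2 z x2 -> lmM x1 m1 = lmM x2 m2) ->
  forall x y p, y <> x -> ~ pvars p y ->
  lmM x (prec p) = lmM y (prec (pperm (swap_var x y) p)).
Proof.
move=> swCg x y p yx py.
have [z] : exists z,
    ~ (pvars p `|` pvars (pperm (swap_var x y) p) `|` [set x; y]) z.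
  apply: exists_fresh => //; rewrite !finite_setU; split.
    by split; exact: finite_pvars.
  by split; exact: finite_set1.
move=> /not_orP[/not_orP[pz qz] /not_orP[zx zy]].
apply: (swCg _ _ _ _ z) => //; try by apply: prec_fr => /pFV_pvars.
(* The two swapped bodies are equal already as preterms: both permutations send [x] to [z] and fix
   every other variable of [p]. *)
rewrite -!prec_swap pperm_comp; congr prec; apply: eq_in_pperm => v pv /=.
have [->|/eqP vx] := eqVneq v x; first by rewrite swap_var_l !swap_var_r.
have vy : v <> y by move=> vy; rewrite vy in pv.
have vz : v <> z by move=> vz; rewrite vz in pv.
by rewrite (swap_var_id vx vy) !swap_var_id.
Qed.

End Swapping.

End Freshness.

(** * Models with renaming only *)

Section Renset.
Variable renM : M -> Var -> Var -> M.
Hypothesis renVr : forall x y z, renM (vrM x) y z = vrM (ren_var y z x).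
Hypothesis renAp : forall m n y z,
  renM (apM m n) y z = apM (renM m y z) (renM n y z).
Hypothesis renLm1 : forall x m y z, x <> y -> x <> z ->
  renM (lmM x m) y z = lmM x (renM m y z).
Hypothesis renLm2 : forall x m z, renM (lmM x m) z x = lmM x m.
Hypothesis renBvr2 : forall m x x' y, y <> x' ->
  lmM x (renM m y x') = lmM x' (renM (renM m y x') x' x).
Hypothesis renIm : forall m x1 x2 y, x1 <> y ->
  renM (renM m x1 y) x2 y = renM m x1 y.

(* Freshness is not primitive here: x is fresh for m when renaming x has no
   effect, and by renIm a single renaming to some y <> x suffices. *)
Let frM x m := forall y, renM m y x = m.

Let frM1 x y m : y <> x -> renM m y x = m -> frM x m.
Proof. by move=> yx <- z; exact: renIm. Qed.

Let frVr x z : z <> x -> frM z (vrM x).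
Proof. by move=> /nesym/eqP/negbTE xz y; rewrite renVr /ren_var xz. Qed.

Let frAp m n z : frM z m -> frM z n -> frM z (apM m n).
Proof. by move=> mz nz y; rewrite renAp mz nz. Qed.

Let frLm x m z : z = x \/ frM z m -> frM z (lmM x m).
Proof.
have [->|/eqP zx] := eqVneq z x; first by move=> _ y; exact: renLm2.
(* The test variable [y] must differ from [z] for [frM1] and from [x] for [renLm1]. *)
move=> [//|mz]; have [y [yx yz]] := exists_neq2 x z.
by apply: (frM1 yz); rewrite renLm1 ?mz //; exact: nesym.
Qed.

(** When [x'] is fresh for [m], [m] equals [renM m y x'] for some [y] other than [x'], which is the
    shape required by [renBvr2]. *)
Let renBvr m x x' : x' <> x -> frM x' m -> lmM x m = lmM x' (renM m x' x).
Proof.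
move=> xx' mx'; have [y [yx' _]] := exists_neq2 x' x'.
by rewrite -{1}(mx' y) renBvr2 // mx'.
Qed.

Lemma prec_bound_renset x y p : y <> x -> ~ pvars p y ->
  lmM x (prec p) = lmM y (prec (pperm (swap_var x y) p)).
Proof. exact: (prec_bound_ren frVr frAp frLm renVr renAp renLm1 renBvr). Qed.

Lemma trec_renset t y z : trec (ren_term t y z) = renM (trec t) y z.
Proof. exact: (trec_ren frVr frAp frLm renVr renAp renLm1 renBvr). Qed.

End Renset.

(** * Models with swapping and free variables *)

Section SwappingFree.
Variables (swM : M -> Var -> Var -> M) (fvM : M -> set Var).
Hypothesis swVr : forall x z1 z2,
  swM (vrM x) z1 z2 = vrM (swap_var z1 z2 x).
Hypothesis swAp : forall m1 m2 z1 z2,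
  swM (apM m1 m2) z1 z2 = apM (swM m1 z1 z2) (swM m2 z1 z2).
Hypothesis swLm : forall x m z1 z2,
  swM (lmM x m) z1 z2 = lmM (swap_var z1 z2 x) (swM m z1 z2).

Section Free.
Hypothesis fvVr : forall x, fvM (vrM x) `<=` [set x].
Hypothesis fvAp : forall m n, fvM (apM m n) `<=` fvM m `|` fvM n.
Hypothesis fvLm : forall x m, fvM (lmM x m) `<=` fvM m `\ x.

Lemma prec_fv p : fvM (prec p) `<=` pFV p.
Proof.
elim: p => /= [x|p IHp q IHq|x p IHp]; first exact: fvVr.
  by move=> y /fvAp[/IHp|/IHq]; [left|right].
by move=> y /fvLm[/IHp].
Qed.

Lemma trec_fv t : fvM (trec t) `<=` FV_term t.
Proof. exact: prec_fv. Qed.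

(** By [swLm], the right-hand side is the left-hand side with [x] and [y] swapped, and neither is
    free in the left-hand side. *)
Lemma prec_bound_swap_free :
  (forall m x y, ~ fvM m x -> ~ fvM m y -> swM m x y = m) ->
  forall x y p, y <> x -> ~ pvars p y ->
  lmM x (prec p) = lmM y (prec (pperm (swap_var x y) p)).
Proof.
move=> swFv x y p yx py; rewrite (prec_swap swVr swAp swLm).
have := swLm x (prec p) x y; rewrite swap_var_l => <-.
by rewrite swFv // => /fvLm[]; [move=> _ /(_ erefl)|move=> /prec_fv /pFV_pvars].
Qed.

End Free.

(** * Free variables defined as the support under swapping *)

Section SmallSupport.
Hypothesis swId : forall m z, swM m z z = m.
Hypothesis swIv : forall m x y, swM (swM m x y) x y = m.
Hypothesis swCp : forall m x y z1 z2, swM (swM m x y) z1 z2 =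
  swM (swM m z1 z2) (swap_var z1 z2 x) (swap_var z1 z2 y).
Hypothesis fvDSw : forall m,
  fvM m = [set x | infinite_set [set y | swM m x y <> m]].
Hypothesis fcb : exists x, forall m, ~ fvM (lmM x m) x.

Let fvP m x : ~ fvM m x <-> finite_set [set y | swM m x y <> m].
Proof. by rewrite fvDSw; split=> [/contrapT|fin inf] //; exact: inf fin. Qed.

(** The transposition of [x] and [y] is the conjugate of that of [x] and [z] by that of [y] and [z];
    for all but finitely many [z], both of the latter fix [m]. *)
Lemma sw_fv m x y : ~ fvM m x -> ~ fvM m y -> swM m x y = m.
Proof.
have [->|/eqP xy] := eqVneq x y; first by rewrite swId.
move=> /fvP mx /fvP my.
have [z] : exists z, ~ ([set z | swM m x z <> m] `|`
    [set z | swM m y z <> m] `|` [set x; y]) z.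
  by apply: exists_fresh => //; rewrite !finite_setU.
move=> /not_orP[/not_orP[/contrapT mxz /contrapT myz] /not_orP[zx zy]].
have := swCp m x z y z; rewrite mxz myz swap_var_r swap_var_id //.
by move=> xz; apply: zx.
Qed.

Lemma fv_vr x : fvM (vrM x) `<=` [set x].
Proof.
move=> z; apply: contraPP => zx; apply/fvP.
apply: sub_finite_set (finite_set1 x) => y /=; rewrite swVr.
by apply: contra_notP => yx; rewrite swap_var_id //; exact: nesym.
Qed.

Lemma fv_ap m n : fvM (apM m n) `<=` fvM m `|` fvM n.
Proof.
move=> z; apply: contraPP => /not_orP[/fvP mz /fvP nz]; apply/fvP.
apply: sub_finite_set (_ : finite_set (_ `|` _)); last first.
  by rewrite finite_setU; split; [exact: mz|exact: nz].
move=> y /=; rewrite swAp; apply: contra_notP.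
by move=> /not_orP[/contrapT -> /contrapT ->].
Qed.

(* Swapping x with the variable provided by fcb carries the freshness of the
   latter in its abstractions over to x. *)
Lemma fv_lm_bound x m : ~ fvM (lmM x m) x.
Proof.
(* The body of [m0] is swapped in advance, so that swapping [x0] and [x] in [m0] gives back
   [lmM x m]. *)
have [x0 fcb0] := fcb; set m0 := lmM x0 (swM m x0 x).
have -> : lmM x m = swM m0 x0 x by rewrite swLm swIv swap_var_l.
have [->|/eqP xx0] := eqVneq x x0; first by rewrite swId; exact: fcb0.
apply/fvP; apply: sub_finite_set (_ : finite_set
    ([set y | swM m0 x0 y <> m0] `|` [set x0; x])); last first.
  by rewrite finite_setU; split; [exact/fvP/fcb0|exact: finite_set2].
move=> y /=; apply: contra_notP => /not_orP[/contrapT m0y /not_orP[yx0 yx]].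
(* Conjugation by the exchange of [x0] and [x] turns the swapping of [x0] and [y], which fixes [m0],
   into that of [x] and [y]. *)
have := swCp m0 x0 y x0 x; by rewrite m0y swap_var_l swap_var_id.
Qed.

Lemma fv_lm x m : fvM (lmM x m) `<=` fvM m `\ x.
Proof.
move=> z lz; have zx : z <> x.
  by move=> zx; move: lz; rewrite zx; exact: fv_lm_bound.
split=> //; apply: contraPP lz => /fvP mz; apply/fvP.
apply: sub_finite_set (_ : finite_set ([set y | swM m z y <> m] `|` [set x])).
  move=> y /=; apply: contra_notP => /not_orP[/contrapT mzy yx].
  by rewrite swLm mzy swap_var_id //; exact: nesym.
by rewrite finite_setU; split=> //; exact: finite_set1.
Qed.

Lemma prec_bound_swap_support x y p : y <> x -> ~ pvars p y ->
  lmM x (prec p) = lmM y (prec (pperm (swap_var x y) p)).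
Proof. exact: prec_bound_swap_free fv_vr fv_ap fv_lm sw_fv _ _ _. Qed.

End SmallSupport.
End SwappingFree.

End Recursion.

(** * The term model *)

Section TermModel.
Variable Var : countType.
Hypothesis Var_inf : infinite_set [set: Var].

(** Each property is checked once over its own symbols and then transferred to every signature by
    [satisfies_term]. *)
Definition term_holds (P : property Var) : Prop :=
  holds (term_model Var (symbols P)).

Lemma term_SwVr : term_holds (SwVr Var).
Proof. by move=> x z1 z2; exact: perm_Vr. Qed.

Lemma term_SwAp : term_holds (SwAp Var).
Proof. by move=> t u z1 z2; exact: perm_Ap. Qed.

Lemma term_SwLm : term_holds (SwLm Var).
Proof. by move=> x t z1 z2; exact: perm_Lm. Qed.

Lemma term_SwId : term_holds (SwId Var).
Proof.
move=> t z; rewrite -[RHS]perm_id; congr perm_term.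
by apply: perm_ext => v /=; rewrite swap_varxx.
Qed.

Lemma term_SwIv : term_holds (SwIv Var).
Proof.
move=> t x y; rewrite -[RHS]perm_id -[LHS]/(perm_term _ _) perm_comp.
by congr perm_term; apply: perm_ext => v /=; exact: swap_varK.
Qed.

Lemma term_SwCp : term_holds (SwCp Var).
Proof.
move=> t x y z1 z2 /=; rewrite /swap_term !perm_comp; congr perm_term.
by apply: perm_ext => v /=; exact/swap_var_morph/swap_var_inj.
Qed.

Lemma term_SwFv : term_holds (SwFv Var).
Proof. by move=> t x y; rewrite !notin_setE; exact: swap_fix. Qed.

Lemma term_SwBvr : term_holds (SwBvr Var).
Proof.
move=> t x x' _ /=; rewrite /fresh_term notin_setE swap_termC; exact: Lm_swap.
Qed.

Lemma term_SwCg : term_holds (SwCg Var).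
Proof.
move=> t u x1 x2 z /= _ _; rewrite /fresh_term !notin_setE => tz uz tu.
rewrite (Lm_swap Var_inf x1 tz) (Lm_swap Var_inf x2 uz).
by rewrite swap_termC tu swap_termC.
Qed.

Lemma term_PmVr : term_holds (PmVr Var).
Proof. by move=> x s; exact: perm_Vr. Qed.

Lemma term_PmAp : term_holds (PmAp Var).
Proof. by move=> t u s; exact: perm_Ap. Qed.

Lemma term_PmLm : term_holds (PmLm Var).
Proof. by move=> x t s; exact: perm_Lm. Qed.

Lemma term_PmId : term_holds (PmId Var).
Proof. by move=> t; exact: perm_id. Qed.

Lemma term_PmCp : term_holds (PmCp Var).
Proof. by move=> t s s'; exact: perm_comp. Qed.

Lemma term_PmFv : term_holds (PmFv Var).
Proof.
move=> t s st; apply: perm_fix => // v tv; apply: contrapT => sv.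
by have : (supp s `&` FV_term t) v by []; rewrite st.
Qed.

Lemma term_SbVr : term_holds (SbVr Var).
Proof. by move=> x u z; exact: subst_Vr. Qed.

Lemma term_SbAp : term_holds (SbAp Var).
Proof. by move=> t1 t2 u z; exact: subst_Ap. Qed.

Lemma term_SbLm : term_holds (SbLm Var).
Proof.
by move=> x t u z /= /eqP xz; rewrite /fresh_term notin_setE; exact: subst_Lm.
Qed.

Lemma term_SbBvr : term_holds (SbBvr Var).
Proof.
by move=> t x x' _ /=; rewrite /fresh_term notin_setE; exact: Lm_subst.
Qed.

Lemma term_RnVr : term_holds (RnVr Var).
Proof. by move=> x y z; exact: ren_Vr. Qed.

Lemma term_RnAp : term_holds (RnAp Var).
Proof. by move=> t u y z; exact: ren_Ap. Qed.

Lemma term_RnLm1 : term_holds (RnLm1 Var).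
Proof. by move=> x t y z /eqP xy /eqP xz; exact: ren_Lm. Qed.

Lemma term_RnLm2 : term_holds (RnLm2 Var).
Proof.
by move=> x t z; apply: ren_fix => //; rewrite FV_Lm => -[_ /(_ erefl)].
Qed.

Lemma term_RnBvr : term_holds (RnBvr Var).
Proof. exact: term_SbBvr. Qed.

Lemma term_RnId : term_holds (RnId Var).
Proof.
move=> t z /=; rewrite ren_termE //; apply: tsubst_fix => // v _ /=.
by rewrite /ren_var; case: eqP => [->|].
Qed.

Lemma term_RnBvr2 : term_holds (RnBvr2 Var).
Proof.
move=> t x x' y /eqP yx' /=; exact/Lm_subst/ren_notin.
Qed.

Lemma term_RnIm : term_holds (RnIm Var).
Proof.
by move=> t x1 x2 y /eqP x1y; apply: ren_fix => //; exact: ren_notin.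
Qed.

Lemma term_RnCh : term_holds (RnCh Var).
Proof.
move=> t x1 x2 x3 y /eqP yx2 /=.
have : ~ FV_term (ren_term t y x2) x2 by exact: ren_notin.
(* The first renaming has removed [x2] from the free variables; on the remaining ones, passing from
   [x1] through [x2] to [x3] is passing from [x1] to [x3]. *)
move: (ren_term t y x2) => u ux2; rewrite ren_ren // ren_termE //.
apply: eq_in_tsubst => v uv /=; rewrite /ren_var.
have [_|_] := eqVneq v x1; first by rewrite eqxx.
by case: eqP => // vx2; rewrite vx2 in uv.
Qed.

Lemma term_RnCm : term_holds (RnCm Var).
Proof.
move=> t x1 x2 y1 y2 x2y1 y1x1 x1y2 /=; rewrite !ren_ren //.
apply: eq_in_tsubst => v _ /=; rewrite /ren_var.
have [->|vx1] := eqVneq v x1.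
  by rewrite (negbTE x2y1) [x1 == y1]eq_sym (negbTE y1x1) eqxx.
have [_|_] := eqVneq v y1; last by rewrite (negbTE vx1).
by rewrite [y2 == x1]eq_sym (negbTE x1y2).
Qed.

Lemma term_FrVr : term_holds (FrVr Var).
Proof. by move=> x z /eqP zx /=; rewrite /fresh_term notin_setE FV_Vr. Qed.

Lemma term_FrAp : term_holds (FrAp Var).
Proof.
move=> t u z /=; rewrite /fresh_term !notin_setE FV_Ap => tz uz.
exact/not_orP.
Qed.

Lemma term_FrLm : term_holds (FrLm Var).
Proof.
move=> x t z /=; rewrite /fresh_term !notin_setE FV_Lm.
by move=> [->|tz] [] => [_ /(_ erefl)|/tz].
Qed.

Lemma term_FvVr : term_holds (FvVr Var).
Proof. by move=> x /=; rewrite FV_Vr. Qed.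

Lemma term_FvAp : term_holds (FvAp Var).
Proof. by move=> t u /=; rewrite FV_Ap. Qed.

Lemma term_FvLm : term_holds (FvLm Var).
Proof. by move=> x t /=; rewrite FV_Lm. Qed.

(** If [x] is not free in [t], only the finitely many free [y] can change [t]. If [x] is free, every
    [y] that is not free changes [t], because it becomes free. *)
Lemma term_FvDSw : term_holds (FvDSw Var).
Proof.
move=> t /=; apply/seteqP; split=> x /= tx; last first.
  apply: contrapT => tx'; apply: tx.
  apply: sub_finite_set (finite_FV t) => y /=.
  by apply: contra_notP; exact: swap_fix.
move=> fin; have [y] : exists y,
    ~ ([set y | swap_term t x y <> t] `|` FV_term t) y.
  apply: exists_fresh => //.
  by rewrite finite_setU; split=> //; exact: finite_FV.
move=> /not_orP[/contrapT txy ty]; apply: ty.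
by rewrite -txy FV_perm; exists x => //=; rewrite swap_var_l.
Qed.

Lemma term_FvDPm : term_holds (FvDPm Var).
Proof. exact: term_FvDSw. Qed.

Lemma term_FCB : term_holds (FCB Var).
Proof.
have [x _] := exists_fresh Var_inf (finite_set0 Var).
by exists x => t /=; rewrite notin_setE FV_Lm => -[_ /(_ erefl)].
Qed.

Local Hint Resolve term_SwVr term_SwAp term_SwLm term_SwId term_SwIv
  term_SwCp term_SwFv term_SwBvr term_SwCg term_PmVr term_PmAp term_PmLm
  term_PmId term_PmCp term_PmFv term_SbVr term_SbAp term_SbLm term_SbBvr
  term_RnVr term_RnAp term_RnLm1 term_RnLm2 term_RnBvr term_RnId term_RnBvr2
  term_RnIm term_RnCh term_RnCm term_FrVr term_FrAp term_FrLm term_FvVr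
  term_FvAp term_FvLm term_FvDSw term_FvDPm term_FCB : core.

(** A reduct of a term model is again a term model, by computation. *)
Lemma satisfies_term S (P : property Var) :
  {subset symbols P <= S} -> term_holds P -> satisfies (term_model Var S) P.
Proof. by move=> h; exists h. Qed.

Lemma term_model_sat i :
  satisfies_all (term_model Var (Sig Var i)) (props Var i).
Proof.
by case: i; repeat constructor; apply: satisfies_term => //; exact/allP.
Qed.
End TermModel.

(** * Initiality *)

(* Replaces a proof of a membership that computes to true by isT, so that the
   operations of a reduct become syntactically those of the model. *)
Definition normal_proof (b : bool) : b -> b :=
  if b return b -> b then fun _ => isT else id.

Lemma normal_proofE (b : bool) (h : b) : normal_proof h = h.
Proof. exact: bool_irrelevance. Qed.

Section Models.
Variable Var : countType.
Hypothesis Var_inf : infinite_set [set: Var].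

(** The inclusion hidden in [satisfies] is opaque; proof irrelevance replaces it by one that
    computes. *)
Lemma satisfies_holds S (M : model Var S) (P : property Var) :
  satisfies M P -> forall sub : all (fun s => s \in S) (symbols P),
  holds (reduct (fun s hs => normal_proof (allP sub s hs)) M).
Proof.
move=> [h hP] sub.
by rewrite (_ : (fun s hs => _) = h) //; exact: Prop_irrelevance.
Qed.

(** A conjunction that intro patterns can take apart; over a concrete signature each [sub] is given
    by [isT]. *)
Fixpoint all_hold S (M : model Var S) (Ps : seq (property Var)) : Prop :=
  if Ps isn't P :: Ps then True else
  (forall sub : all (fun s => s \in S) (symbols P),
    holds (reduct (fun s hs => normal_proof (allP sub s hs)) M)) /\
  all_hold M Ps.

Lemma satisfies_all_hold S (M : model Var S) Ps :
  satisfies_all M Ps -> all_hold M Ps.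
Proof. by elim=> {Ps} //= P Ps MP _ IH; split=> //; exact: satisfies_holds. Qed.

(** After case analysis on the symbol, the goals mention the operations at [isT], as the properties
    obtained from [all_hold] do. *)
Lemma normal_morphism S (M N : model Var S) (g : M -> N) :
  (forall s (hs : s \in S), preserves g (interp M (normal_proof hs))
     (interp N (normal_proof hs))) -> is_morphism g.
Proof. by move=> gP s hs; rewrite -(normal_proofE hs). Qed.

Lemma term_morphism_unique S (M : model Var S)
    (f g : morphism (term_model Var S) M) :
  {subset sig_ctor <= S} -> f = g.
Proof.
move=> ctorS; apply: morphism_eq; apply/funext => t.
have [vrS apS lmS] : [/\ vr \in S, ap \in S & lm \in S] by split; exact: ctorS.
have [fV gV] := (svalP f vr vrS, svalP g vr vrS).
have [fA gA] := (svalP f ap apS, svalP g ap apS).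
have [fL gL] := (svalP f lm lmS, svalP g lm lmS).
elim/term_ind: t => [x|t u IHt IHu|x t IHt].
- by rewrite [LHS]fV [RHS]gV.
- by rewrite [LHS]fA [RHS]gA IHt IHu.
- by rewrite [LHS]fL [RHS]gL IHt.
Qed.

(** The existence half of initiality; [term_morphism_unique] is the other half. *)
Definition has_recursor S (M : model Var S) : Prop :=
  exists g : term_model Var S -> M, is_morphism g.

(** * Morphisms out of the term model, one axiomatisation at a time *)

Lemma recursor_perm_free_support (M : model Var (Sig Var i1)) :
  satisfies_all M (props Var i1) -> has_recursor M.
Proof.
move=> /satisfies_all_hold[PmVr [PmAp [PmLm [PmId [PmCp [FvDPm [FCB _]]]]]]].
move: (PmVr isT) (PmAp isT) (PmLm isT) (PmId isT) (PmCp isT) (FvDPm isT)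
  (FCB isT) => /=.
set V := @interp _ _ M vr isT; set A := @interp _ _ M ap isT;
  set L := @interp _ _ M lm isT; set P := @interp _ _ M pm isT;
  set F := @interp _ _ M fv isT.
move=> {}PmVr {}PmAp {}PmLm {}PmId {}PmCp {}FvDPm {}FCB.
(* Acting by transpositions yields a swapping operation, for which [FvDPm] reads as [FvDSw]. *)
pose W m x y := P m (transp x y).
have SwVr x z1 z2 : W (V x) z1 z2 = V (swap_var z1 z2 x) by exact: PmVr.
have SwAp m n z1 z2 : W (A m n) z1 z2 = A (W m z1 z2) (W n z1 z2).
  exact: PmAp.
have SwLm x m z1 z2 : W (L x m) z1 z2 = L (swap_var z1 z2 x) (W m z1 z2).
  exact: PmLm.
have SwId m z : W m z z = m.
  rewrite -[RHS]PmId; congr P; apply: perm_ext => v /=.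
  by rewrite swap_varxx.
have SwIv m x y : W (W m x y) x y = m.
  rewrite /W PmCp -[RHS]PmId; congr P; apply: perm_ext => v /=.
  exact: swap_varK.
have SwCp m x y z1 z2 : W (W m x y) z1 z2 =
    W (W m z1 z2) (swap_var z1 z2 x) (swap_var z1 z2 y).
  rewrite /W !PmCp; congr P; apply: perm_ext => v /=.
  exact/swap_var_morph/swap_var_inj.
have {}FCB : exists x, forall m, ~ F (L x m) x.
  by case: FCB => x FCB; exists x => m; rewrite -notin_setE.
have bound :=
  prec_bound_swap_support Var_inf SwVr SwAp SwLm SwId SwIv SwCp FvDPm FCB.
exists (trec V A L); apply: normal_morphism; case=> //= hs.
- exact: trec_Vr.
- exact: trec_Ap.
- exact: trec_Lm.
(* Invariance used transpositions; preservation concerns every permutation [s]. *)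
- by move=> t s; exact: (trec_perm bound (f := P^~ s)).
- move=> t; apply: trec_fv.
  + exact: fv_vr SwVr FvDPm.
  + exact: fv_ap SwAp FvDPm.
  + exact: fv_lm SwLm SwId SwIv SwCp FvDPm FCB.
Qed.

Lemma recursor_perm_free (M : model Var (Sig Var i2)) :
  satisfies_all M (props Var i2) -> has_recursor M.
Proof.
move=> /satisfies_all_hold[PmVr [PmAp [PmLm [PmId [PmCp [PmFv [FvVr [FvAp
  [FvLm _]]]]]]]]].
move: (PmVr isT) (PmAp isT) (PmLm isT) (PmId isT) (PmCp isT) (PmFv isT)
  (FvVr isT) (FvAp isT) (FvLm isT) => /=.
set V := @interp _ _ M vr isT; set A := @interp _ _ M ap isT;
  set L := @interp _ _ M lm isT; set P := @interp _ _ M pm isT;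
  set F := @interp _ _ M fv isT.
move=> {}PmVr {}PmAp {}PmLm {}PmId {}PmCp {}PmFv {}FvVr {}FvAp {}FvLm.
pose W m x y := P m (transp x y).
have SwVr x z1 z2 : W (V x) z1 z2 = V (swap_var z1 z2 x) by exact: PmVr.
have SwAp m n z1 z2 : W (A m n) z1 z2 = A (W m z1 z2) (W n z1 z2).
  exact: PmAp.
have SwLm x m z1 z2 : W (L x m) z1 z2 = L (swap_var z1 z2 x) (W m z1 z2).
  exact: PmLm.
(* The support of a transposition contains at most [x] and [y]. *)
have SwFv m x y : ~ F m x -> ~ F m y -> W m x y = m.
  move=> mx my; apply: PmFv; rewrite -subset0 => v [/= vxy mv].
  by apply: vxy; apply: swap_var_id => vz; rewrite vz in mv.
have bound := prec_bound_swap_free SwVr SwAp SwLm FvVr FvAp FvLm SwFv.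
exists (trec V A L); apply: normal_morphism; case=> //= hs.
- exact: trec_Vr.
- exact: trec_Ap.
- exact: trec_Lm.
- by move=> t s; exact: (trec_perm bound (f := P^~ s)).
- by move=> t; exact: trec_fv.
Qed.

Lemma recursor_swap_free_support (M : model Var (Sig Var i3)) :
  satisfies_all M (props Var i3) -> has_recursor M.
Proof.
move=> /satisfies_all_hold[SwVr [SwAp [SwLm [SwId [SwIv [SwCp [FvDSw [FCB
  _]]]]]]]].
move: (SwVr isT) (SwAp isT) (SwLm isT) (SwId isT) (SwIv isT) (SwCp isT)
  (FvDSw isT) (FCB isT) => /=.
set V := @interp _ _ M vr isT; set A := @interp _ _ M ap isT;
  set L := @interp _ _ M lm isT; set W := @interp _ _ M sw isT;
  set F := @interp _ _ M fv isT.
move=> {}SwVr {}SwAp {}SwLm {}SwId {}SwIv {}SwCp {}FvDSw {}FCB.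
have {}FCB : exists x, forall m, ~ F (L x m) x.
  by case: FCB => x FCB; exists x => m; rewrite -notin_setE.
have bound :=
  prec_bound_swap_support Var_inf SwVr SwAp SwLm SwId SwIv SwCp FvDSw FCB.
exists (trec V A L); apply: normal_morphism; case=> //= hs.
- exact: trec_Vr.
- exact: trec_Ap.
- exact: trec_Lm.
- by move=> t x y; exact: (trec_perm bound (f := fun m => W m x y)).
- move=> t; apply: trec_fv.
  + exact: fv_vr SwVr FvDSw.
  + exact: fv_ap SwAp FvDSw.
  + exact: fv_lm SwLm SwId SwIv SwCp FvDSw FCB.
Qed.

Lemma recursor_swap_free (M : model Var (Sig Var i4)) :
  satisfies_all M (props Var i4) -> has_recursor M.
Proof.
move=> /satisfies_all_hold[SwVr [SwAp [SwLm [SwFv [FvVr [FvAp [FvLm _]]]]]]].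
move: (SwVr isT) (SwAp isT) (SwLm isT) (SwFv isT) (FvVr isT) (FvAp isT)
  (FvLm isT) => /=.
set V := @interp _ _ M vr isT; set A := @interp _ _ M ap isT;
  set L := @interp _ _ M lm isT; set W := @interp _ _ M sw isT;
  set F := @interp _ _ M fv isT.
move=> {}SwVr {}SwAp {}SwLm {}SwFv {}FvVr {}FvAp {}FvLm.
have {}SwFv m x y : ~ F m x -> ~ F m y -> W m x y = m.
  by move=> mx my; apply: SwFv; rewrite notin_setE.
have bound := prec_bound_swap_free SwVr SwAp SwLm FvVr FvAp FvLm SwFv.
exists (trec V A L); apply: normal_morphism; case=> //= hs.
- exact: trec_Vr.
- exact: trec_Ap.
- exact: trec_Lm.
- by move=> t x y; exact: (trec_perm bound (f := fun m => W m x y)).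
- by move=> t; exact: trec_fv.
Qed.

Lemma recursor_swap_fresh (M : model Var (Sig Var i5)) :
  satisfies_all M (props Var i5) -> has_recursor M.
Proof.
move=> /satisfies_all_hold[SwVr [SwAp [SwLm [SwBvr [FrVr [FrAp [FrLm _]]]]]]].
move: (SwVr isT) (SwAp isT) (SwLm isT) (SwBvr isT) (FrVr isT) (FrAp isT)
  (FrLm isT) => /=.
set V := @interp _ _ M vr isT; set A := @interp _ _ M ap isT;
  set L := @interp _ _ M lm isT; set W := @interp _ _ M sw isT;
  set K := @interp _ _ M fr isT.
move=> {}SwVr {}SwAp {}SwLm {}SwBvr {}FrVr {}FrAp {}FrLm.
have {}FrVr x z : z <> x -> K z (V x) by move=> /eqP; exact: FrVr.
have {}SwBvr m x x' : x' <> x -> K x' m -> L x m = L x' (W m x' x).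
  by move=> /eqP; exact: SwBvr.
have bound := prec_bound_swap_fresh FrVr FrAp FrLm SwVr SwAp SwLm SwBvr.
exists (trec V A L); apply: normal_morphism; case=> //= hs.
- exact: trec_Vr.
- exact: trec_Ap.
- exact: trec_Lm.
- by move=> t x y; exact: (trec_perm bound (f := fun m => W m x y)).
- move=> x t; rewrite /fresh_term notin_setE; exact: (prec_fr FrVr FrAp FrLm).
Qed.

Lemma recursor_swap_fresh_cong (M : model Var (Sig Var i6)) :
  satisfies_all M (props Var i6) -> has_recursor M.
Proof.
move=> /satisfies_all_hold[SwVr [SwAp [SwLm [SwCg [FrVr [FrAp [FrLm _]]]]]]].
move: (SwVr isT) (SwAp isT) (SwLm isT) (SwCg isT) (FrVr isT) (FrAp isT)
  (FrLm isT) => /=.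
set V := @interp _ _ M vr isT; set A := @interp _ _ M ap isT;
  set L := @interp _ _ M lm isT; set W := @interp _ _ M sw isT;
  set K := @interp _ _ M fr isT.
move=> {}SwVr {}SwAp {}SwLm {}SwCg {}FrVr {}FrAp {}FrLm.
have {}FrVr x z : z <> x -> K z (V x) by move=> /eqP; exact: FrVr.
have {}SwCg m1 m2 x1 x2 z : z <> x1 -> z <> x2 -> K z m1 -> K z m2 ->
    W m1 z x1 = W m2 z x2 -> L x1 m1 = L x2 m2.
  by move=> /eqP zx1 /eqP; exact: SwCg.
have bound := prec_bound_swap_cg Var_inf FrVr FrAp FrLm SwVr SwAp SwLm SwCg.
exists (trec V A L); apply: normal_morphism; case=> //= hs.
- exact: trec_Vr.
- exact: trec_Ap.
- exact: trec_Lm.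
- by move=> t x y; exact: (trec_perm bound (f := fun m => W m x y)).
- move=> x t; rewrite /fresh_term notin_setE; exact: (prec_fr FrVr FrAp FrLm).
Qed.

Lemma recursor_subst_fresh (M : model Var (Sig Var i7)) :
  satisfies_all M (props Var i7) -> has_recursor M.
Proof.
move=> /satisfies_all_hold[SbVr [SbAp [SbLm [SbBvr [FrVr [FrAp [FrLm _]]]]]]].
move: (SbVr isT) (SbAp isT) (SbLm isT) (SbBvr isT) (FrVr isT) (FrAp isT)
  (FrLm isT) => /=.
set V := @interp _ _ M vr isT; set A := @interp _ _ M ap isT;
  set L := @interp _ _ M lm isT; set B := @interp _ _ M sb isT;
  set K := @interp _ _ M fr isT.
move=> {}SbVr {}SbAp {}SbLm {}SbBvr {}FrVr {}FrAp {}FrLm.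
have {}FrVr x z : z <> x -> K z (V x) by move=> /eqP; exact: FrVr.
have {}SbLm x m n z : x <> z -> K x n -> B (L x m) n z = L x (B m n z).
  by move=> /eqP; exact: SbLm.
have {}SbBvr m x x' : x' <> x -> K x' m -> L x m = L x' (B m (V x') x).
  by move=> /eqP; exact: SbBvr.
have bound := prec_bound_sb Var_inf FrVr FrAp FrLm SbVr SbAp SbLm SbBvr.
exists (trec V A L); apply: normal_morphism; case=> //= hs.
- exact: trec_Vr.
- exact: trec_Ap.
- exact: trec_Lm.
- exact (trec_subst Var_inf FrVr FrAp FrLm SbVr SbAp SbLm SbBvr).
- move=> x t; rewrite /fresh_term notin_setE; exact: (prec_fr FrVr FrAp FrLm).
Qed.

Lemma recursor_ren (M : model Var (Sig Var i8)) :
  satisfies_all M (props Var i8) -> has_recursor M.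
Proof.
move=> /satisfies_all_hold[RnVr [RnAp [RnLm1 [RnLm2 [RnBvr2 [RnId [RnIm [RnCh
  [RnCm _]]]]]]]]].
move: (RnVr isT) (RnAp isT) (RnLm1 isT) (RnLm2 isT) (RnBvr2 isT) (RnId isT)
  (RnIm isT) (RnCh isT) (RnCm isT) => /=.
set V := @interp _ _ M vr isT; set A := @interp _ _ M ap isT;
  set L := @interp _ _ M lm isT; set R := @interp _ _ M ren isT.
move=> {}RnVr {}RnAp {}RnLm1 {}RnLm2 {}RnBvr2 {}RnId {}RnIm {}RnCh {}RnCm.
have {}RnLm1 x m y z : x <> y -> x <> z -> R (L x m) y z = L x (R m y z).
  by move=> /eqP xy /eqP; exact: RnLm1.
have {}RnBvr2 m x x' y : y <> x' -> L x (R m y x') = L x' (R (R m y x') x' x).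
  by move=> /eqP; exact: RnBvr2.
have {}RnIm m x1 x2 y : x1 <> y -> R (R m x1 y) x2 y = R m x1 y.
  by move=> /eqP; exact: RnIm.
have bound := prec_bound_renset Var_inf RnVr RnAp RnLm1 RnLm2 RnBvr2 RnIm.
exists (trec V A L); apply: normal_morphism; case=> //= hs.
- exact: trec_Vr.
- exact: trec_Ap.
- exact: trec_Lm.
- exact (trec_renset Var_inf RnVr RnAp RnLm1 RnLm2 RnBvr2 RnIm).
Qed.

Lemma recursor_ren_fresh (M : model Var (Sig Var i9)) :
  satisfies_all M (props Var i9) -> has_recursor M.
Proof.
move=> /satisfies_all_hold[RnVr [RnAp [RnLm1 [RnBvr [FrVr [FrAp [FrLm
  _]]]]]]].
move: (RnVr isT) (RnAp isT) (RnLm1 isT) (RnBvr isT) (FrVr isT) (FrAp isT)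
  (FrLm isT) => /=.
set V := @interp _ _ M vr isT; set A := @interp _ _ M ap isT;
  set L := @interp _ _ M lm isT; set R := @interp _ _ M ren isT;
  set K := @interp _ _ M fr isT.
move=> {}RnVr {}RnAp {}RnLm1 {}RnBvr {}FrVr {}FrAp {}FrLm.
have {}FrVr x z : z <> x -> K z (V x) by move=> /eqP; exact: FrVr.
have {}RnLm1 x m y z : x <> y -> x <> z -> R (L x m) y z = L x (R m y z).
  by move=> /eqP xy /eqP; exact: RnLm1.
have {}RnBvr m x x' : x' <> x -> K x' m -> L x m = L x' (R m x' x).
  by move=> /eqP; exact: RnBvr.
have bound := prec_bound_ren Var_inf FrVr FrAp FrLm RnVr RnAp RnLm1 RnBvr.
exists (trec V A L); apply: normal_morphism; case=> //= hs.
- exact: trec_Vr.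
- exact: trec_Ap.
- exact: trec_Lm.
- exact (trec_ren Var_inf FrVr FrAp FrLm RnVr RnAp RnLm1 RnBvr).
- move=> x t; rewrite /fresh_term notin_setE; exact: (prec_fr FrVr FrAp FrLm).
Qed.

Lemma recursor_exists i (M : model Var (Sig Var i)) :
  satisfies_all M (props Var i) -> has_recursor M.
Proof.
case: i M.
- exact: recursor_perm_free_support.
- exact: recursor_perm_free.
- exact: recursor_swap_free_support.
- exact: recursor_swap_free.
- exact: recursor_swap_fresh.
- exact: recursor_swap_fresh_cong.
- exact: recursor_subst_fresh.
- exact: recursor_ren.
- exact: recursor_ren_fresh.
Qed.

End Models.

Theorem mainTheorem1 (Var : countType) (Var_inf : infinite_set [set: Var])
    (i : recursor_index) :
  exists Htr : satisfies_all (term_model Var (Sig Var i)) (props Var i),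
    epi_recursor (recursor Htr) /\
    @initial (ext_models Var i) (exist _ (term_model Var (Sig Var i)) Htr).
Proof.
exists (term_model_sat Var_inf i).
have init : @initial (ext_models Var i)
    (exist _ (term_model Var (Sig Var i)) (term_model_sat Var_inf i)).
  move=> [M Msat]; have [g gM] := recursor_exists Var_inf Msat.
  exists (exist _ g gM) => f.
  exact: term_morphism_unique (@sig_ctor_sub Var i).
(* The forgetful functor sends the term model to the term model over the constructors by
   computation, so [init] settles both conjuncts. *)
by [].
Qed.
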